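(* Let $J\ge 1$ and let $u^j:A^j\to\mathbb{R}$, $j=1,\dots,J$, be concave valuations on finite nonempty sets $A^j\subset\mathbb{Z}^2$ (so there are $n=2$ product types). If the product-mix auction $\{u^1,\dots,u^J\}$ is stable, then it has competitive equilibrium; that is, for every $a\in\operatorname{conv}_{\mathbb{Z}}(A^1+\cdots+A^J)$ there exists a price $p\in\mathbb{R}^2$ with $a\in D_U(p)$, where $U$ is the aggregate valuation of all $J$ agents.
   Context: For $A\subset\mathbb{R}^n$ write $\operatorname{conv}_{\mathbb{Z}}(A)=\operatorname{conv}(A)\cap\mathbb{Z}^n$. A valuation is a function $u:A\to\mathbb{R}$ with $A\subset\mathbb{Z}^n$ finite and nonempty. Its concave majorant $\widetilde u$ is the smallest concave function on $\operatorname{conv}(A)$ with $\widetilde u(a)\ge u(a)$ for all $a\in A$. The valuation $u$ is called concave if $A=\operatorname{conv}_{\mathbb{Z}}(A)$ and $u=\widetilde u$ on $A$. For a price $p\in\mathbb{R}^n$ the demand set is $D_u(p)=\arg\max_{a\in A}\{u(a)-p\cdot a\}$. The tropical polynomial of $u$ is $f_u(x)=\max\{u(a)+a\cdot x\mid a\in A\}$, $x\in\mathbb{R}^n$, and its tropical hypersurface $T(f_u)$ is the set of $x\in\mathbb{R}^n$ at which this maximum is attained by at least two elements $a\in A$. Given valuations $u^j:A^j\to\mathbb{R}$ of a finite set of agents $j$, put $A=\sum_j A^j$ (Minkowski sum); the aggregate valuation is $U:A\to\mathbb{R}$, $U(a)=\max\{\sum_j u^j(a^j)\mid a^j\in A^j,\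 \sum_j a^j=a\}$. The auction (set of valuations) has competitive equilibrium at $a\in\operatorname{conv}_{\mathbb{Z}}(A)$ if there is $p\in\mathbb{R}^n$ with $a\in D_U(p)$; it has competitive equilibrium if this holds for every $a\in\operatorname{conv}_{\mathbb{Z}}(A)$. Stable auction: consider an auction with $J\ge1$ agents with concave valuations. Partition the agents into $K\le J$ disjoint nonempty sets, and let $U^k$ be the aggregate valuation of the $k$-th set of agents, $1\le k\le K$. The partition is stable if the auction consisting of the first set of agents has competitive equilibrium and $T(f_{U^k})\subseteq T(f_{U^1})$ for all $k=1,\dots,K$. The auction is stable if it has a stable partition. *)

(* Defs.v *)
From HB Require Import structures.
From mathcomp Require Import all_boot all_order all_algebra.
From mathcomp Require Import all_classical all_reals convex.

Set Implicit Arguments.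
Unset Strict Implicit.
Unset Printing Implicit Defensive.

Import Order.TTheory GRing.Theory Num.Theory.

Local Open Scope classical_set_scope.
Local Open Scope ring_scope.

Section Lattice.
Context {R : realType} {n : nat}.

Definition embed (a : 'rV[int]_n) : 'rV[R]_n := map_mx intr a.

Definition dotr (x y : 'rV[R]_n) : R := \sum_(i < n) x 0 i * y 0 i.

Definition convex_hull (A : set 'rV[R]_n) : set 'rV[R]_n :=
  [set x | exists (m : nat) (w : 'I_m -> R) (a : 'I_m -> 'rV[R]_n),
     [/\ forall i, 0 <= w i,
         \sum_(i < m) w i = 1,
         forall i, A (a i) &
         x = \sum_(i < m) w i *: a i]].

Definition concave_function (D : set 'rV[R]_n) (g : 'rV[R]_n -> R) : Prop :=
  convex_function D (fun x => - g x).

End Lattice.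

Definition convZ (R : realType) (n : nat) (A : set 'rV[int]_n) :
    set 'rV[int]_n :=
  [set a | convex_hull (embed (R := R) @` A) (embed a)].

(* [value] is total, but nothing below depends on its values outside [dom]. *)
Record valuation (R : realType) (n : nat) := Valuation {
  dom : set 'rV[int]_n ;
  value : 'rV[int]_n -> R ;
  dom_finite : finite_set dom ;
  dom_nonempty : dom !=set0 }.

Section Valuation.
Context {R : realType} {n : nat}.
Implicit Types u : valuation R n.

(* [g] only matters on [convex_hull (embed @` dom u)]. *)
Definition majorizes u (g : 'rV[R]_n -> R) : Prop :=
  concave_function (convex_hull (embed @` dom u)) g /\
  forall a, dom u a -> value u a <= g (embed a).

Definition is_concave_majorant u (g : 'rV[R]_n -> R) : Prop :=
  majorizes u g /\
  forall h, majorizes u h ->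
    forall x, convex_hull (embed @` dom u) x -> g x <= h x.

Definition concave_valuation u : Prop :=
  dom u = convZ R (dom u) /\
  exists2 g, is_concave_majorant u g &
    forall a, dom u a -> value u a = g (embed a).

Definition demand u (p : 'rV[R]_n) : set 'rV[int]_n :=
  [set a | dom u a /\
    forall b, dom u b ->
      value u b - dotr p (embed b) <= value u a - dotr p (embed a)].

(* The sup of a finite nonempty set, hence a max. *)
Definition trop_poly u (x : 'rV[R]_n) : R :=
  sup [set value u a + dotr (embed a) x | a in dom u].

Definition trop_hypersurface u : set 'rV[R]_n :=
  [set x | exists a b, [/\ a <> b, dom u a, dom u b,
     value u a + dotr (embed a) x = trop_poly u x &
     value u b + dotr (embed b) x = trop_poly u x]].

End Valuation.

Section Auction.
Context {R : realType} {n : nat} {I : finType}.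
Implicit Types (u : I -> valuation R n) (S : {set I}).

(* Only the components of [x] in [S] matter. *)
Definition allocation u S : set (I -> 'rV[int]_n) :=
  [set x | forall j, j \in S -> dom (u j) (x j)].

Definition aggregate_dom u S : set 'rV[int]_n :=
  [set \sum_(j in S) x j | x in allocation u S].

(* For [a] in [aggregate_dom u S], the sup of a finite nonempty set, hence
   a max. *)
Definition aggregate_val u S (a : 'rV[int]_n) : R :=
  sup [set \sum_(j in S) value (u j) (x j)
      | x in allocation u S `&` [set x | \sum_(j in S) x j = a]].

Lemma aggregate_dom_finite u S : finite_set (aggregate_dom u S).
Proof.
have fin (s : seq I) : finite_set
    [set \sum_(j <- s) x j | x in [set x | forall j, j \in s -> dom (u j) (x j)]].
  elim: s => [|i s IHs].
    apply: (sub_finite_set _ (finite_set1 0)) => _ [x _ <-] /=.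
    by rewrite big_nil.
  apply: sub_finite_set (finite_image2 +%R (dom_finite (u i)) IHs).
  move=> _ [x xP <-]; exists (x i); first by apply: xP; rewrite mem_head.
  exists (\sum_(j <- s) x j); last by rewrite big_cons.
  by exists x => // j js; apply: xP; rewrite in_cons js orbT.
apply: sub_finite_set (fin (enum S)) => _ [x xP <-].
by exists x => [j|]; [rewrite mem_enum; exact: xP | rewrite big_enum].
Qed.

Lemma aggregate_dom_nonempty u S : aggregate_dom u S !=set0.
Proof.
have [x xP] := boolp.choice (fun j => dom_nonempty (u j)).
by exists (\sum_(j in S) x j); exists x.
Qed.

Definition aggregate u S : valuation R n :=
  Valuation (aggregate_val u S)
    (aggregate_dom_finite u S) (aggregate_dom_nonempty u S).

(* Competitive equilibrium of the auction formed by the agents in [S]. *)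
Definition equilibrium_at u S (a : 'rV[int]_n) : Prop :=
  exists p : 'rV[R]_n, demand (aggregate u S) p a.

Definition competitive_equilibrium u S : Prop :=
  forall a, convZ R (dom (aggregate u S)) a -> equilibrium_at u S a.

(* [S1] plays the role of the first set of agents; the blocks of a
   [finset.partition] are nonempty and pairwise disjoint. *)
Definition stable_partition u (P : {set {set I}}) (S1 : {set I}) : Prop :=
  [/\ finset.partition P [set: I]%SET, S1 \in P, competitive_equilibrium u S1 &
    forall S, S \in P ->
      trop_hypersurface (aggregate u S) `<=`
      trop_hypersurface (aggregate u S1)].

Definition stable_auction u : Prop :=
  exists P S1, stable_partition u P S1.

End Auction.

(* Main.v *)
Require Import Defs.
From mathcomp Require Import all_boot all_order all_algebra.
From mathcomp Require Import all_classical all_reals.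
From mathcomp Require Import convex interval_inference.
From mathcomp Require Import ring lra zify.

Set Implicit Arguments.
Unset Strict Implicit.
Unset Printing Implicit Defensive.

Import Order.TTheory GRing.Theory Num.Theory.

(* By LP duality the bundle [a] lies in the convex hull of the aggregate demand
   [D_U(p)] at some price [p], and [D_U(p)] is the Minkowski sum of the demands
   [D_j(p)] of the single agents. So it suffices that this sum contains all
   lattice points of its convex hull. The demand of the first block does, since
   that block has equilibrium, and the inclusions of tropical hypersurfaces,
   read at prices near [p], say that every edge direction of a polygon
   [D_j(p)] is, with the same outer normal, an edge direction of the demand of
   the first block. The agents can then be added one at a time by the theorem
   of Fakhruddin and Haase-Nill-Paffenholz-Santos: if the normal fan of [P]
   refines that of [Q], then every lattice point [x] of [P + Q] is a sum of
   lattice points of [P] and [Q].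

   For the latter, put [A = x - P]. The hulls of [A] and [Q] meet, and we look
   for a common lattice point. If there is none, the half-planes of the edges
   along which one polygon leaves the other have no common lattice point, and
   by Doignon's theorem four of them already have none. If at most one of the
   four belongs to [A], a lattice point of [Q] satisfies all of them. Otherwise
   at most two, [V1] and [V2], belong to [Q], and it is enough that [A] has a
   lattice point in [V1] and [V2]. The line bounding [Vi] cuts [A] in a section
   shorter than one primitive step, while by hypothesis [A] has an edge parallel
   to it on the inner side, of length at least one step. If [V1] and [V2] had no
   common lattice point in [A], the two segments joining the endpoints of these
   two edges would have to converge in two incompatible directions. *)

(** * Linear programming duality *)

Section Farkas.
Local Open Scope ring_scope.

Lemma between_finite (R : realFieldType) (I : finType) (L U : pred I)
    (f : I -> R) :
  (forall j i, L j -> U i -> f j <= f i) ->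
  exists x, (forall j, L j -> f j <= x) /\ (forall i, U i -> x <= f i).
Proof.
move=> LU; case: (pickP L) => [j0 Lj0|L0].
  by case: (@arg_maxP _ _ _ j0 L f Lj0) => j Lj jmax; exists (f j); split=> [|i /(LU _ _ Lj)].
case: (pickP U) => [i0 Ui0|U0].
  by case: (@arg_minP _ _ _ i0 U f Ui0) => i Ui imin; exists (f i); split=> // j; rewrite L0.
by exists 0; split=> [j|i]; rewrite ?L0 ?U0.
Qed.

(* Fourier-Motzkin elimination of the first variable; [M] lists the
   nonnegative row combinations in which it cancels. *)
Lemma farkas_ord (R : realFieldType) n (I : finType) (A : I -> 'I_n -> R)
    (b : I -> R) :
  (exists x : 'I_n -> R, forall i, \sum_k A i k * x k <= b i) \/
  (exists y : I -> R, [/\ forall i, 0 <= y i,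
     forall k, \sum_i y i * A i k = 0 & \sum_i y i * b i < 0]).
Proof.
elim: n => [|n IHn] in I A b *.
  case: (pickP (fun i => b i < 0)) => [i bi|b0]; [right|left].
    exists (fun j => (j == i)%:R); split=> [j||]; rewrite ?ler0n//; first by case.
    rewrite (bigD1 i)//= eqxx mul1r big1 ?addr0// => j /negPf ->.
    by rewrite mul0r.
  by exists (fun=> 0) => i; rewrite big_ord0 leNgt b0.
pose a i := A i ord0.
pose M (r : I + I * I) (k : I) : R := match r with
  | inl i => (a i == 0)%:R * (k == i)%:R
  | inr (i, j) => ((0 < a i) && (a j < 0))%:R *
                  (- a j * (k == i)%:R + a i * (k == j)%:R) end.
have M_ge0 r k : 0 <= M r k.
  case: r => [i|[i j]] /=; first by rewrite mulr_ge0.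
  case: andP => [[i0 j0]|_]; last by rewrite mul0r.
  by rewrite mul1r addr_ge0// mulr_ge0// ?oppr_ge0 ltW.
have delta (i : I) (F : I -> R) : \sum_k (k == i)%:R * F k = F i.
  rewrite (bigD1 i)//= eqxx mul1r big1 ?addr0// => j /negPf ->.
  by rewrite mul0r.
have ME r (F : I -> R) : \sum_k M r k * F k = match r with
  | inl i => (a i == 0)%:R * F i
  | inr (i, j) => ((0 < a i) && (a j < 0))%:R * (- a j * F i + a i * F j) end.
  case: r => [i|[i j]] /=.
    by under eq_bigr do rewrite -mulrA; rewrite -mulr_sumr delta.
  under eq_bigr do rewrite -mulrA mulrDl -!mulrA.
  by rewrite -mulr_sumr big_split/= -!mulr_sumr !delta.
have Ma r : \sum_k M r k * a k = 0.
  rewrite ME; case: r => [i|[i j]]; first by case: eqP => [->|_]; rewrite ?mulr0 ?mul0r.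
  by rewrite mulrC mulNr (mulrC (a j)) addNr mul0r.
have [[x xP]|[y [y0 yA yb]]] := IHn _
    (fun r k => \sum_i M r i * A i (lift ord0 k)) (fun r => \sum_i M r i * b i).
  left; pose s i := \sum_k A i (lift ord0 k) * x k.
  have sP r : \sum_i M r i * s i <= \sum_i M r i * b i.
    apply: le_trans (xP r); rewrite le_eqVlt; apply/orP; left; apply/eqP.
    under eq_bigr do rewrite mulr_sumr.
    rewrite exchange_big/=; apply: eq_bigr => k _; rewrite mulr_suml.
    by apply: eq_bigr => i _; rewrite mulrA.
  (* The combined rows [inr (i, j)] say exactly that each lower bound on the first variable is at
     most each upper bound. *)
  have [|x0 [lo up]] := @between_finite R I (fun j => a j < 0) (fun i => 0 < a i)
      (fun i => (b i - s i) / a i).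
    move=> j i aj ai; have := sP (inr (i, j)); rewrite !ME ai aj/= !mul1r => h.
    rewrite ler_pdivlMr// mulrAC ler_ndivrMr//; nra.
  exists (fun k => oapp x x0 (unlift ord0 k)) => i.
  rewrite big_ord_recl unlift_none/= -/(a i).
  under eq_bigr do rewrite liftK/=.
  rewrite -/(s i); case: (ltrgtP (a i) 0) => [ai|ai|ai].
  - by have := lo _ ai; rewrite ler_ndivrMr//; lra.
  - by have := up _ ai; rewrite ler_pdivlMr//; lra.
  - by have := sP (inl i); rewrite !ME ai eqxx !mul1r; lra.
right; exists (fun i => \sum_r y r * M r i).
have yE (F : I -> R) :
    \sum_i (\sum_r y r * M r i) * F i = \sum_r y r * \sum_i M r i * F i.
  under eq_bigr do rewrite mulr_suml.
  rewrite exchange_big/=; apply: eq_bigr => r _; rewrite mulr_sumr.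
  by apply: eq_bigr => i _; rewrite mulrA.
split=> [i|k|]; last by rewrite yE.
  by apply: sumr_ge0 => r _; rewrite mulr_ge0.
rewrite yE; case: (unliftP ord0 k) => [k' ->|->]; first exact: yA.
by rewrite big1// => r _; rewrite Ma mulr0.
Qed.

Lemma farkas (R : realFieldType) (X I : finType) (A : I -> X -> R)
    (b : I -> R) :
  (exists x : X -> R, forall i, \sum_k A i k * x k <= b i) \/
  (exists y : I -> R, [/\ forall i, 0 <= y i,
     forall k, \sum_i y i * A i k = 0 & \sum_i y i * b i < 0]).
Proof.
have [[x xP]|[y [y0 yA yb]]] := @farkas_ord R #|X| I (fun i k => A i (enum_val k)) b.
  left; exists (x \o enum_rank) => i; have := xP i.
  rewrite [X in _ -> X <= _](reindex (@enum_val X predT)) /=; last first.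
    by apply: onW_bij; exact: enum_val_bij.
  by under [X in _ -> X <= _]eq_bigr do rewrite enum_valK.
by right; exists y; split=> // k; have := yA (enum_rank k); rewrite enum_rankK.
Qed.

End Farkas.

Section Duality.
Local Open Scope ring_scope.

(** Primal feasibility, dual feasibility and the absence of a duality gap form one linear system in
    [w] and [p], to which [farkas] applies. The hypothesis on [q] says in dual form that [y] lies in
    the cone of the rows of [s]. *)
Lemma lp_duality (R : realFieldType) (I K : finType) (s : I -> K -> R)
    (y : K -> R) (u : I -> R) (p0 : K -> R) :
  (forall i, u i <= \sum_k p0 k * s i k) ->
  (forall q : K -> R, (forall i, 0 <= \sum_k q k * s i k) ->
     0 <= \sum_k q k * y k) ->
  exists (w : I -> R) (p : K -> R), [/\ forall i, 0 <= w i,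
    forall k, \sum_i w i * s i k = y k,
    forall i, u i <= \sum_k p k * s i k &
    \sum_k p k * y k <= \sum_i w i * u i].
Proof.
move=> p0P yP.
pose A (r : (I + bool * K) + (I + unit)) (x : I + K) : R := match r, x with
  | inl (inl i), inl j => - (j == i)%:R
  | inl (inr (t, k)), inl j => (if t then 1 else -1) * s j k
  | inr (inl i), inr k => - s i k
  | inr (inr _), inl j => - u j
  | inr (inr _), inr k => y k
  | _, _ => 0 end.
pose b (r : (I + bool * K) + (I + unit)) : R := match r with
  | inl (inl i) => 0
  | inl (inr (t, k)) => (if t then 1 else -1) * y k
  | inr (inl i) => - u i
  | inr (inr _) => 0 end.
have [[x xP]|[z [z0 zA zb]]] := farkas A b.
  exists (x \o inl), (x \o inr); split=> [i|k|i|] /=.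
  - have := xP (inl (inl i)); rewrite big_sumType/= (bigD1 i)//= eqxx big1.
      rewrite big1 => [|k _]; last by rewrite mul0r.
      by rewrite mulN1r !addr0 oppr_le0.
    by move=> j /negPf ->; rewrite oppr0 mul0r.
  - have e t : (if t then 1 else -1) * (\sum_i x (inl i) * s i k) <=
        (if t then 1 else -1) * y k.
      have := xP (inl (inr (t, k))); rewrite big_sumType/=.
      rewrite [X in _ + X]big1 ?addr0 => [|? _]; last by rewrite mul0r.
      by rewrite mulr_sumr; under eq_bigr do rewrite -mulrA (mulrC (s _ _)).
    have := e true; have := e false; lra.
  - have := xP (inr (inl i)); rewrite big_sumType/= big1 ?add0r => [|? _]; last by rewrite mul0r.
    under eq_bigr do rewrite mulNr mulrC.
    by rewrite sumrN lerN2.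
  - have := xP (inr (inr tt)); rewrite big_sumType/=.
    under eq_bigr do rewrite mulNr mulrC.
    under [X in _ + X <= _ -> _]eq_bigr do rewrite mulrC.
    by rewrite sumrN; lra.
exfalso.
(* Divided by the multiplier [v] of the gap row, [m] and [q] would be feasible solutions violating
   weak duality. If [v = 0], then [q] contradicts [yP], because [p0] bounds the sum of the
   [m i * u i] by 0. *)
pose q k := z (inl (inr (true, k))) - z (inl (inr (false, k))).
pose m i := z (inr (inl i)); pose v := z (inr (inr tt)).
have split_bool (F : bool * K -> R) :
    \sum_r F r = \sum_k (F (true, k) + F (false, k)).
  rewrite (eq_bigr (fun r => F (r.1, r.2))); last by case.
  by rewrite -(pair_bigA _ (fun t k => F (t, k)))/= big_bool big_split.
have qs j : v * u j <= \sum_k q k * s j k.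
  have := zA (inl j); rewrite !big_sumType/= split_bool/=.
  rewrite [X in _ + (X + _)]big1 ?add0r => [|? _]; last by rewrite mulr0.
  rewrite (bigD1 j)//= eqxx [X in _ + X + _ + _]big1; last first.
    by move=> i; rewrite eq_sym => /negPf ->; rewrite oppr0 mulr0.
  rewrite (big_pred1 tt) => [|[]//].
  rewrite (eq_bigr (fun k => q k * s j k)) => [|k _]; last by rewrite /q; ring.
  by have := z0 (inl (inl j)); rewrite -/v mulrN1; lra.
have ms k : \sum_i m i * s i k = v * y k.
  have := zA (inr k); rewrite !big_sumType/=.
  rewrite [X in X + _ + _]big1 => [|? _]; last by rewrite mulr0.
  rewrite [X in _ + X + _]big1 => [|[? ?] _]; last by rewrite mulr0.
  rewrite (big_pred1 tt) => [|[]//].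
  under eq_bigr do rewrite mulrN.
  rewrite sumrN -/v /m; lra.
have lt : \sum_k q k * y k < \sum_i m i * u i.
  have := zb; rewrite !big_sumType/= split_bool/=.
  rewrite [X in X + _ + _]big1 => [|? _]; last by rewrite mulr0.
  rewrite (big_pred1 tt) => [|[]//].
  rewrite (eq_bigr (fun k => q k * y k)) => [|k _]; last by rewrite /q; ring.
  under [X in _ + (X + _)]eq_bigr do rewrite mulrN.
  rewrite sumrN /m; lra.
have v0 : 0 <= v by exact: z0.
have msum (p : K -> R) : \sum_i m i * (\sum_k p k * s i k) = v * \sum_k p k * y k.
  under eq_bigr do rewrite mulr_sumr.
  rewrite exchange_big/= mulr_sumr; apply: eq_bigr => k _.
  rewrite mulrCA -ms mulr_sumr; apply: eq_bigr => i _; ring.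
have [v_eq0|v_neq0] := eqVneq v 0.
  have h : \sum_i m i * u i <= \sum_i m i * (\sum_k p0 k * s i k).
    by apply: ler_sum => i _; rewrite ler_wpM2l// z0.
  have := yP q (fun j => _); rewrite leNgt => /(_ _)/negP; apply.
    by move=> j; have := qs j; rewrite v_eq0 mul0r.
  by rewrite (lt_le_trans lt)// (le_trans h)// msum v_eq0 mul0r.
have v_gt0 : 0 < v by rewrite lt_def v_neq0.
have h : \sum_i m i * (v * u i) <= \sum_i m i * (\sum_k q k * s i k).
  by apply: ler_sum => i _; rewrite ler_wpM2l// z0.
have e : \sum_i m i * (v * u i) = v * \sum_i m i * u i.
  by rewrite mulr_sumr; apply: eq_bigr => i _; ring.
by move: h; rewrite e msum ler_pM2l// leNgt lt.
Qed.

End Duality.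

(** * Convex hulls and supporting prices *)

Section Hull.
Local Open Scope classical_set_scope.
Local Open Scope ring_scope.
Context {R : realType} {n : nat}.
Implicit Types (A B : set 'rV[R]_n) (x y : 'rV[R]_n).

Lemma sub_hull A : A `<=` convex_hull A.
Proof.
move=> x Ax; exists 1%N, (fun=> 1), (fun=> x).
by split=> //; rewrite big_ord1 ?scale1r.
Qed.

Lemma hull_mono A B : A `<=` B -> convex_hull A `<=` convex_hull B.
Proof. by move=> AB x [m [w [a [w0 w1 Aa ->]]]]; exists m, w, a; split=> // i; exact: AB. Qed.

(** The first point is split off and the other weights are divided by their sum [t], so closure
    under segments suffices. *)
Lemma hull_ind A B : A `<=` B ->
  (forall x y t, 0 <= t <= 1 -> B x -> B y -> B ((1 - t) *: x + t *: y)) ->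
  convex_hull A `<=` B.
Proof.
move=> AB Bconv _ [m [w [a [w0 w1 Aa ->]]]].
elim: m => [|m IHm] in w a w0 w1 Aa *.
  by move: w1; rewrite big_ord0 => /eqP; rewrite eq_sym oner_eq0.
move: w1; rewrite !big_ord_recl; set t := \sum_(i < m) _ => w1.
have t0 : 0 <= t by exact: sumr_ge0.
have [t_eq0|t_neq0] := eqVneq t 0.
  rewrite big1 ?addr0; first by move: w1; rewrite t_eq0 addr0 => ->; rewrite scale1r; apply: AB.
  move=> i _; have /eqP := t_eq0; rewrite psumr_eq0// => /allP/(_ i).
  by rewrite mem_index_enum => /(_ isT)/eqP ->; rewrite scale0r.
have -> : w ord0 = 1 - t by rewrite -w1 addrK.
have -> : \sum_(i < m) w (lift ord0 i) *: a (lift ord0 i) =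
    t *: \sum_(i < m) (w (lift ord0 i) / t) *: a (lift ord0 i).
  by rewrite scaler_sumr; apply: eq_bigr => i _; rewrite scalerA mulrC divfK.
apply: Bconv; first by rewrite t0/= -w1 lerDr.
- exact: AB.
- apply: IHm => //; first by move=> i; rewrite divr_ge0.
  by rewrite -mulr_suml divff.
Qed.

Lemma hull_segment A x y t : 0 <= t <= 1 -> convex_hull A x ->
  convex_hull A y -> convex_hull A ((1 - t) *: x + t *: y).
Proof.
case/andP=> t0 t1 [m [w [a [w0 w1 Aa ->]]]] [m' [w' [a' [w'0 w'1 Aa' ->]]]].
exists (m + m')%N, (fun i : 'I_(m + m') => match fintype.split i with
  | inl j => (1 - t) * w j | inr j => t * w' j end),
  (fun i : 'I_(m + m') => match fintype.split i with inl j => a j | inr j => a' j end).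
have splitl (j : 'I_m) : fintype.split (lshift m' j) = inl j by exact: (unsplitK (inl j)).
have splitr (j : 'I_m') : fintype.split (rshift m j) = inr j by exact: (unsplitK (inr j)).
split.
- by move=> i; case: fintype.split => j; rewrite mulr_ge0// subr_ge0.
- rewrite big_split_ord/=; under eq_bigr do rewrite splitl.
  under [X in _ + X]eq_bigr do rewrite splitr.
  by rewrite -!mulr_sumr w1 w'1 !mulr1 subrK.
- by move=> i; case: fintype.split => j.
rewrite big_split_ord/=; under [in RHS]eq_bigr do rewrite splitl.
under [X in _ = _ + X]eq_bigr do rewrite splitr.
by rewrite !scaler_sumr; congr (_ + _); apply: eq_bigr => i _; rewrite scalerA.
Qed.

Lemma hull_le A (f : 'rV[R]_n -> R) c : scalar f ->
  (forall x, A x -> f x <= c) -> forall x, convex_hull A x -> f x <= c.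
Proof.
move=> flin Ac; apply: hull_ind => // x y t /andP[t0 t1] xc yc.
have f0 : f 0 = 0.
  by have := flin 1 0 0; rewrite scaler0 addr0 mul1r; lra.
rewrite flin -[t *: y]addr0 flin f0 addr0.
have -> : c = (1 - t) * c + t * c by ring.
by rewrite lerD// ler_wpM2l// subr_ge0.
Qed.

Lemma dotr_scalar (p : 'rV[R]_n) : scalar (dotr p).
Proof.
move=> a x y; rewrite /dotr mulr_sumr -big_split/=; apply: eq_bigr => i _.
by rewrite !mxE; ring.
Qed.

(** Duality for the largest average of [u] over the convex combinations of the [e s] equal to [y].
    The extra coordinate [None], constantly 1, normalises the weights, and its price is [c]. By
    complementary slackness only points of surplus [c] carry weight. *)
Lemma supporting_price (T : eqType) (S : set T) (e : T -> 'rV[R]_n)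
    (u : T -> R) y : finite_set S -> convex_hull (e @` S) y ->
  exists p c, (forall s, S s -> u s - dotr p (e s) <= c) /\
    convex_hull (e @` [set s | S s /\ u s - dotr p (e s) = c]) y.
Proof.
move=> /finite_seqP[l ->] yP.
pose t (i : 'I_(size l)) := tnth (in_tuple l) i.
have tl i : t i \in l by exact: mem_tnth.
pose s i (k : option 'I_n) := if k is Some k then e (t i) 0 k else 1.
pose y' (k : option 'I_n) := if k is Some k then y 0 k else 1.
have big_opt (F : option 'I_n -> R) : \sum_k F k = F None + \sum_k F (Some k).
  rewrite (bigD1 None)//=; congr (_ + _).
  rewrite (reindex_omap Some id) => [|[]]//=.
  by apply: eq_bigl => k; rewrite eqxx.
(* [M] bounds every value of [u], so zero prices with [c = M] are dual feasible. *)
pose M := \sum_i `|u (t i)|.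
have [|q qs|w [p [w0 ws pu py]]] := @lp_duality R 'I_(size l) _ s y' (u \o t)
    (fun k => if k is None then M else 0).
- move=> i; rewrite big_opt /= mulr1 big1 ?addr0 => [|k _]; last by rewrite mul0r.
  rewrite /M (bigD1 i)//= (le_trans (ler_norm _))// lerDl sumr_ge0// => j _.
- pose v : 'rV[R]_n := \row_k - q (Some k).
  have vE (z : 'rV[R]_n) : \sum_k q (Some k) * z 0 k = - dotr v z.
    by rewrite /dotr -sumrN; apply: eq_bigr => k _; rewrite mxE mulNr opprK.
  rewrite big_opt /= mulr1 vE subr_ge0.
  apply: (hull_le (dotr_scalar v)) yP => _ [x xl <-].
  have /tnthP[i ->] : x \in in_tuple l by [].
  by have := qs i; rewrite big_opt /= mulr1 vE subr_ge0.
pose P : 'rV[R]_n := \row_k p (Some k).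
have PE (z : 'rV[R]_n) : \sum_k p (Some k) * z 0 k = dotr P z.
  by rewrite /dotr; apply: eq_bigr => k _; rewrite mxE.
exists P, (p None); split=> [x xl|].
  have /tnthP[i ->] : x \in in_tuple l by [].
  by have := pu i; rewrite big_opt /= mulr1 PE lerBlDr.
have wsum : \sum_i w i = 1.
  by have := ws None; under eq_bigr do rewrite /= mulr1.
have wy : y = \sum_i w i *: e (t i).
  apply/rowP => k; rewrite summxE; under eq_bigr do rewrite mxE.
  by have := ws (Some k).
have gap i : 0 <= w i * (\sum_k p k * s i k - u (t i)).
  by rewrite mulr_ge0// subr_ge0 pu.
have gap0 i : w i != 0 -> u (t i) - dotr P (e (t i)) = p None.
  have : \sum_i w i * (\sum_k p k * s i k - u (t i)) <= 0.
    under eq_bigr do rewrite mulrBr mulr_sumr.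
    rewrite sumrB exchange_big/= subr_le0; apply: le_trans py.
    rewrite le_eqVlt; apply/orP; left; apply/eqP; apply: eq_bigr => k _.
    rewrite -ws mulr_sumr; apply: eq_bigr => j _; ring.
  rewrite le_eqVlt ltNge sumr_ge0//= orbF psumr_eq0// => /allP/(_ i).
  rewrite mem_index_enum => /(_ isT); rewrite mulf_eq0 => /orP[->//|/eqP].
  by rewrite big_opt/= mulr1 PE => h _; lra.
have [i0 wi0] : exists i, w i != 0.
  apply: contrapT => h; have /eqP := wsum.
  rewrite big1 ?[0 == 1]eq_sym ?oner_eq0// => i _.
  by apply/eqP/negPn/negP => wi; apply: h; exists i.
(* [convex_hull] wants every listed point in the set, so points of weight zero are replaced by the
   one of index [i0]. *)
exists (size l), w, (fun i => e (t (if w i == 0 then i0 else i))); split=> //.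
  move=> i; exists (t (if w i == 0 then i0 else i)) => //.
  by case: (eqVneq (w i) 0) => wi; split; rewrite ?gap0//; exact: tl.
rewrite wy; apply: eq_bigr => i _.
by case: eqVneq => // ->; rewrite !scale0r.
Qed.

End Hull.

(** * Doignon's theorem in the plane *)

Section Doignon.
Local Open Scope ring_scope.

(** The determinant. Every linear form on the plane is some [cross d], and it is nonpositive to the
    right of [d]. *)
Definition cross {K : comRingType} (x y : 'rV[K]_2) : K :=
  x 0 0 * y 0 1 - x 0 1 * y 0 0.

Lemma crossD (K : comRingType) (d x y : 'rV[K]_2) :
  cross d (x + y) = cross d x + cross d y.
Proof. by rewrite /cross !mxE; ring. Qed.

Definition parity (x : 'rV[int]_2) : bool * bool :=
  ((x 0%R 0%R %% 2)%Z == 0, (x 0%R 1%R %% 2)%Z == 0).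

Lemma same_parity_midpoint (x y : 'rV[int]_2) : parity x = parity y ->
  exists z, x + y = z + z.
Proof.
case=> h0 h1; exists (\row_i ((x 0%R i + y 0%R i)%R %/ 2)%Z).
have half (m k : int) : ((m %% 2)%Z == 0) = ((k %% 2)%Z == 0) ->
    m + k = ((m + k)%R %/ 2)%Z + ((m + k)%R %/ 2)%Z.
  by case: eqP; case: eqP => //; lia.
apply/rowP => i; rewrite !mxE.
have [->|->] : i = 0 \/ i = 1; [|exact: half h0|exact: half h1].
by case: i => [[|[]]]// h; [left|right]; apply/val_inj.
Qed.

(* The measure is the total violation. The midpoint [z] of two witnesses of
   equal parity violates a constraint [i] by less than the witness [x i]; so
   relaxing [c i] to the value at [z], or replacing [x i] by a point found
   after doing so, decreases the measure. *)
Lemma doignon_witnesses (I : finType) (B : {set I}) (d : I -> 'rV[int]_2)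
    (c : I -> int) (x : I -> 'rV[int]_2) :
  (4 < #|B|)%N ->
  (forall i, i \in B -> c i < cross (d i) (x i)) ->
  (forall i j, i \in B -> j \in B -> j != i -> cross (d j) (x i) <= c j) ->
  exists z, forall j, j \in B -> cross (d j) z <= c j.
Proof.
move=> B4.
move: {2}(\sum_(i in B) `|cross (d i) (x i) - c i|)%N.+1
  (ltnSn (\sum_(i in B) `|cross (d i) (x i) - c i|)%N) => m.
elim: m => // m IHm in c x *; rewrite ltnS => le_m xi xj.
(* More than four witnesses share only four parities. *)
have /dinjectivePn[i iB [j /andP[/= ji jB] pij]] :
    ~~ dinjectiveb (parity \o x) (mem B).
  apply/negP => /dinjectiveP inj.
  have := card_in_imset inj; move: (max_card (mem ((parity \o x) @: B)%SET)).
  by rewrite card_prod card_bool => + e; rewrite e leqNgt B4.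
have [z zE] := same_parity_midpoint pij.
have zD k : cross (d k) (x i) + cross (d k) (x j) = cross (d k) z + cross (d k) z.
  by rewrite -!crossD zE.
have rec k : k \in B -> c k < cross (d k) z ->
    cross (d k) z < cross (d k) (x k) ->
    exists z, forall j, j \in B -> cross (d j) z <= c j.
  move=> kB ckz kz.
  pose c' l := if l == k then cross (d k) z else c l.
  have [[z' z'P]|noz'] :=
      pselect (exists z', forall l, l \in B -> cross (d l) z' <= c' l).
    have z'k : cross (d k) z' <= cross (d k) z.
      by have := z'P k kB; rewrite /c' eqxx.
    have z'l l : l \in B -> l != k -> cross (d l) z' <= c l.
      by move=> lB /negPf lk; have := z'P l lB; rewrite /c' lk.
    (* A solution of the relaxed system either solves the original one or is a witness for [k] with
       smaller violation than [x k]. *)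
    have [z'c|cz'] := leP (cross (d k) z') (c k).
      by exists z' => l lB; have [->//|/z'l->//] := eqVneq l k.
    apply: (IHm c (fun l => if l == k then z' else x l)).
    - apply: leq_trans le_m; rewrite (bigD1 k kB) [X in (_ < X)%N](bigD1 k kB)/= eqxx.
      rewrite -addSn leq_add//; first by lia.
      by apply/eq_leq/eq_bigr => l /andP[_ /negPf ->].
    - by move=> l lB; case: eqVneq => [->//|_]; exact: xi.
    - move=> l l' lB l'B; case: (eqVneq l k) => [->|_]; first exact: z'l.
      exact: xj.
  case: noz'; apply: (IHm c' x).
  - apply: leq_trans le_m; rewrite (bigD1 k kB) [X in (_ < X)%N](bigD1 k kB)/= /c' eqxx.
    rewrite -addSn leq_add//; first by lia.
    by apply/eq_leq/eq_bigr => l /andP[_ /negPf ->].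
  - by move=> l lB; rewrite /c'; case: eqVneq => [->//|_]; exact: xi.
  - move=> l l' lB l'B l'l; rewrite /c'; have := xj l l' lB l'B l'l.
    by case: (eqVneq l' k) => [->|//] h; exact: le_trans h (ltW ckz).
(* Both witnesses satisfy the constraints other than [i] and [j], hence so does [z]. At [i] it does
   better than [x i], because [x j] satisfies [i]; likewise at [j]. *)
have [h|zi] := leP (cross (d i) z) (c i); last first.
  by apply: (rec i) => //; have := zD i; have := xj j i jB iB; rewrite eq_sym ji => /(_ isT); lia.
have [h'|zj] := leP (cross (d j) z) (c j); last first.
  by apply: (rec j) => //; have := zD j; have := xj i j iB jB ji; lia.
exists z => k kB; have [->//|ki] := eqVneq k i.
have [->//|kj] := eqVneq k j.
by have := zD k; have := xj i k iB kB ki; have := xj j k jB kB kj; lia.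
Qed.

(** In an inclusion-minimal infeasible subsystem, dropping constraint [i] leaves a solution, which
    violates [i] alone. With more than four such witnesses the subsystem would be feasible. *)
Lemma doignon (I : finType) (d : I -> 'rV[int]_2) (c : I -> int) :
  (forall z, exists i, c i < cross (d i) z) ->
  exists B : {set I}, (#|B| <= 4)%N /\
    forall z, exists2 i, i \in B & c i < cross (d i) z.
Proof.
move=> infeas.
pose P (B : {set I}) := `[< forall z, exists2 i, i \in B & c i < cross (d i) z >].
have [|B /minsetP[/asboolP BP Bmin]] := @ex_minset I P.
  by exists [set: I]%SET; apply/asboolP => z; have [i] := infeas z; exists i; rewrite ?inE.
exists B; split=> //; rewrite leqNgt; apply/negP => B4.
have /boolp.choice[x xP] : forall i, exists x, i \in B ->
    forall j, j \in B -> j != i -> cross (d j) x <= c j.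
  move=> i; have [iB|] := boolP (i \in B); last by exists 0.
  have : ~ P (B :\ i)%SET.
    move=> /Bmin/(_ (subD1set _ _)) e.
    by move: iB; rewrite -e !inE eqxx.
  move=> /negP/asboolPn/existsNP[x xP]; exists x => _ j jB ji; rewrite leNgt.
  by apply/negP => h; apply: xP; exists j => //; rewrite !inE ji.
case: (@doignon_witnesses I B d c x B4).
- move=> i iB; have [j jB] := BP (x i).
  have [->//|ji] := eqVneq j i.
  by rewrite ltNge (xP i iB j jB ji).
- move=> i j iB jB ji; exact: xP i iB j jB ji.
move=> z zP; have [i iB] := BP z.
by rewrite ltNge zP.
Qed.

End Doignon.

(** * Convex hulls of planar lattice sets *)

Section Plane.
Local Open Scope classical_set_scope.
Local Open Scope ring_scope.

Lemma row2P (K : nzRingType) (x y : 'rV[K]_2) :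
  x 0 0 = y 0 0 -> x 0 1 = y 0 1 -> x = y.
Proof.
move=> e0 e1; apply/rowP => i.
have [->|->] // : i = 0 \/ i = 1.
by case: i => [[|[]]]// h; [left|right]; apply/val_inj.
Qed.

Lemma crossB (K : comNzRingType) (d x y : 'rV[K]_2) :
  cross d (x - y) = cross d x - cross d y.
Proof. by rewrite /cross !mxE; ring. Qed.

Lemma crossZl (K : comNzRingType) (a : K) (d x : 'rV[K]_2) :
  cross (a *: d) x = a * cross d x.
Proof. by rewrite /cross !mxE; ring. Qed.

Lemma crossZr (K : comNzRingType) (a : K) (d x : 'rV[K]_2) :
  cross d (a *: x) = a * cross d x.
Proof. by rewrite /cross !mxE; ring. Qed.

Lemma crossC (K : comNzRingType) (d x : 'rV[K]_2) : cross d x = - cross x d.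
Proof. by rewrite /cross; ring. Qed.

Lemma crossxx (K : comNzRingType) (d : 'rV[K]_2) : cross d d = 0.
Proof. by rewrite /cross; ring. Qed.

Lemma cross_scalar (K : comNzRingType) (d : 'rV[K]_2) : scalar (cross d).
Proof. by move=> a x y; rewrite crossD crossZr. Qed.

(** Coprime coordinates, given by Bezout coefficients: these form a linear form with value 1 on [e],
    which reads off multiples of [e]. *)
Definition primitive (e : 'rV[int]_2) :=
  exists k : int * int, k.1 * e 0 0 + k.2 * e 0 1 = 1.

Lemma primitive_decomposition (d : 'rV[int]_2) : d != 0 ->
  exists (g : int) e, [/\ 0 < g, primitive e & d = g *: e].
Proof.
move=> d0; set g := gcdz (d 0 0) (d 0 1).
have g_gt0 : 0 < g.
  rewrite lt_def /g gcdz_eq0 /= andbT; apply: contra_neqN d0 => /andP[/eqP e0 /eqP e1].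
  by apply: row2P; rewrite ?e0 ?e1 mxE.
have [u [v uv]] := Bezoutz (d 0 0) (d 0 1).
have g0 := dvdz_gcdl (d 0 0) (d 0 1); have g1 := dvdz_gcdr (d 0 0) (d 0 1).
exists g, (\row_i (d 0%R i %/ g)%Z); split=> //.
  exists (u, v) => /=; rewrite !mxE; apply: (mulIf (lt0r_neq0 g_gt0)).
  by rewrite mulrDl -!mulrA !divzK// uv mul1r.
by apply: row2P; rewrite !mxE mulrC divzK.
Qed.

Lemma collinear_multiple (K : comNzRingType) (k0 k1 : K) (e x : 'rV[K]_2) :
  k0 * e 0 0 + k1 * e 0 1 = 1 -> cross e x = 0 ->
  x = (k0 * x 0 0 + k1 * x 0 1) *: e.
Proof.
rewrite /cross => k e0; apply: row2P; rewrite !mxE.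
- transitivity (x 0 0 * (k0 * e 0 0 + k1 * e 0 1) +
    k1 * (e 0 0 * x 0 1 - e 0 1 * x 0 0)); last by ring.
  by rewrite k e0 mulr0 mulr1 addr0.
- transitivity (x 0 1 * (k0 * e 0 0 + k1 * e 0 1) -
    k0 * (e 0 0 * x 0 1 - e 0 1 * x 0 0)); last by ring.
  by rewrite k e0 mulr0 mulr1 subr0.
Qed.

Context {R : realType}.
Local Notation embed := (@embed R 2).
Local Notation hull S := (convex_hull (embed @` S)).
Implicit Types (A Q S T : set 'rV[int]_2) (e d s a q : 'rV[int]_2).

Lemma embedD (x y : 'rV[int]_2) : embed (x + y) = embed x + embed y.
Proof. by rewrite /Defs.embed map_mxD. Qed.

Lemma embedB (x y : 'rV[int]_2) : embed (x - y) = embed x - embed y.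
Proof. by rewrite /Defs.embed map_mxB. Qed.

Lemma embedZ (k : int) (x : 'rV[int]_2) : embed (k *: x) = k%:~R *: embed x.
Proof. by rewrite /Defs.embed map_mxZ. Qed.

Lemma cross_embed (x y : 'rV[int]_2) : cross (embed x) (embed y) = (cross x y)%:~R.
Proof. by rewrite /cross !mxE rmorphB !rmorphM. Qed.

Lemma hull_embed S a : S a -> hull S (embed a).
Proof. by move=> Sa; apply: sub_hull; exists a. Qed.

Lemma primitive_line e s (x : 'rV[R]_2) : primitive e ->
  cross (embed e) (x - embed s) = 0 -> exists z : R, x = embed s + z *: embed e.
Proof.
move=> [k ke] ex.
have ke' : k.1%:~R * embed e 0 0 + k.2%:~R * embed e 0 1 = 1 :> R.
  by rewrite !mxE -!rmorphM -rmorphD ke.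
exists (k.1%:~R * (x - embed s) 0 0 + k.2%:~R * (x - embed s) 0 1).
by rewrite -(collinear_multiple ke' ex) addrC subrK.
Qed.

(** The value at [x] is an average of values on [S], so they are not all smaller; [- f] gives the
    other bound. *)
Lemma hull_extremes n (S : set 'rV[R]_n) (f : 'rV[R]_n -> R) x : scalar f ->
  convex_hull S x -> exists a b : 'rV[R]_n, [/\ S a, S b, f a <= f x & f x <= f b].
Proof.
have key g : scalar g -> convex_hull S x -> exists2 b, S b & g x <= g b.
  move=> glin Sx; apply: contrapT => h.
  have {}h b : S b -> g b < g x.
    by move=> Sb; rewrite ltNge; apply/negP => gb; apply: h; exists b.
  case: Sx => m [w [a [w0 w1 Sa xE]]].
  have g0 : g 0 = 0 by have := glin 1 0 0; rewrite scaler0 addr0 mul1r; lra.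
  have gsum : g x = \sum_i w i * g (a i).
    rewrite xE; elim/big_rec2 : _ => [//|i y1 y2 _ <-]; exact: glin.
  have : \sum_i w i * (g x - g (a i)) = 0.
    by under eq_bigr do rewrite mulrBr; rewrite sumrB -mulr_suml w1 mul1r -gsum subrr.
  move/eqP; rewrite psumr_eq0; last by move=> i _; rewrite mulr_ge0// subr_ge0 ltW// h.
  move=> /allP wg; have : \sum_i w i = 0.
    apply: big1 => i _; have := wg i; rewrite mem_index_enum => /(_ isT).
    rewrite mulf_eq0 => /orP[/eqP//|].
    by rewrite subr_eq0 gt_eqF// h.
  by rewrite w1; move/eqP; rewrite oner_eq0.
move=> flin Sx; have [b Sb fb] := key _ flin Sx.
have [|a Sa fa] := key (fun x => - f x) _ Sx.
  by move=> c y z; rewrite flin mulrN opprD.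
by exists a, b; split=> //; rewrite -lerN2.
Qed.

(* LP duality applied to the points [cross g (s - y)] of the real line, with
   values the progress of [s] in the direction [g = z - y]: an optimal solution
   is the last point of the segment from [y] to [z] in the hull. *)
Lemma exit_edge S (y z : 'rV[R]_2) : finite_set S -> hull S y -> ~ hull S z ->
  exists (r t : R) s s', [/\ 0 <= r <= 1, 0 <= t <= 1, S s, S s' &
    (1 - r) *: y + r *: z = (1 - t) *: embed s + t *: embed s'] /\
    (s = s' \/ [/\ s <> s', forall x, S x -> cross (s' - s) (x - s) <= 0 &
       0 < cross (embed (s' - s)) (z - embed s)]).
Proof.
move=> finS Sy Sz; pose g := z - y.
pose dot (u v : 'rV[R]_2) := u 0 0 * v 0 0 + u 0 1 * v 0 1.
have dot_gt0 (u : 'rV[R]_2) : u != 0 -> 0 < dot u u.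
  move=> u0; rewrite /dot lt_def addr_ge0 -?expr2 ?sqr_ge0// andbT.
  apply: contra_neq u0 => /eqP; rewrite paddr_eq0 ?sqr_ge0// !sqrf_eq0.
  by case/andP=> /eqP e0 /eqP e1; apply: row2P; rewrite ?e0 ?e1 mxE.
have dot_scalar u : scalar (dot u) by move=> a v w; rewrite /dot !mxE; ring.
have dotZ u k v : dot u (k *: v) = k * dot u v by rewrite /dot !mxE; ring.
have inj (u v w : 'rV[R]_2) : u != 0 -> dot u v = dot u w ->
    cross u v = cross u w -> v = w.
  move=> /dot_gt0/lt0r_neq0 u0 e1 e2; apply: row2P; apply: (mulfI u0).
  - transitivity (u 0 0 * dot u v - u 0 1 * cross u v); first by rewrite /dot /cross; ring.
    by rewrite e1 e2 /dot /cross; ring.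
  - transitivity (u 0 1 * dot u v + u 0 0 * cross u v); first by rewrite /dot /cross; ring.
    by rewrite e1 e2 /dot /cross; ring.
have g0 : g != 0 by rewrite subr_eq0; apply/eqP => zy; apply: Sz; rewrite zy.
pose e s : 'rV[R]_1 := \row__ cross g (embed s - y).
have e0 : convex_hull (e @` S) 0.
  case: (Sy) => m [w [a [w0 w1 Sa yE]]].
  have /boolp.choice[b bP] i : exists s, S s /\ embed s = a i.
    by have [s] := Sa i; exists s.
  exists m, w, (fun i => e (b i)); split=> // [i|]; first by exists (b i) => //; case: (bP i).
  apply/rowP => i; rewrite !mxE summxE.
  under eq_bigr do rewrite !mxE (bP _).2 crossB mulrBr -crossZr.
  rewrite sumrB -mulr_suml w1 mul1r {1}yE.
  apply/esym/eqP; rewrite subr_eq0; apply/eqP.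
  elim/big_rec2 : _ => [|j u v _ ->]; last by rewrite crossD.
  by rewrite /cross !mxE; ring.
have [p [c [pS [m [w [a [w0 w1 Sa]]]]]]] := supporting_price
  (fun s => dot g (embed s - y)) finS e0.
have /boolp.choice[b bP] i : exists s,
    (S s /\ dot g (embed s - y) - dotr p (e s) = c) /\ e s = a i.
  by have [s] := Sa i; exists s.
(* The supporting price [p] tilts [g] into the normal [n] of a face [F] of [S]; the point [t] of
   this face lies on the line from [y] to [z]. *)
move=> eE; pose n : 'rV[R]_2 := \row_i (if i == 0 then g 0 0 + p 0 0 * g 0 1
  else g 0 1 - p 0 0 * g 0 0).
have nE x : dot n x = dot g x - p 0 0 * cross g x.
  by rewrite /dot /cross !mxE/=; ring.
have nS s : dot n (embed s - y) = dot g (embed s - y) - dotr p (e s).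
  by rewrite nE /dotr big_ord1 mxE.
have nB u v : dot n (u - v) = dot n u - dot n v by rewrite /dot !mxE; ring.
pose F := [set s | S s /\ dot n (embed s - y) = c].
pose t := \sum_i w i *: embed (b i).
have Ft : hull F t.
  exists m, w, (fun i => embed (b i)); split=> // i; exists (b i) => //.
  by have [[? ?] _] := bP i; split=> //; rewrite nS.
have FS : F `<=` S by move=> s [].
have St : hull S t by apply: hull_mono Ft; exact: image_subset.
have nt : dot n (t - y) = c.
  have [_ [_ [[s [_ sc] <-] [s' [_ s'c] <-]]]] := hull_extremes (dot_scalar n) Ft.
  move: sc s'c; rewrite !nB; lra.
have ct : cross g (t - y) = 0.
  have : (0 : 'rV[R]_1) 0 0 = \sum_i w i * cross g (embed (b i) - y).
    rewrite eE summxE; apply: eq_bigr => i _.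
    by rewrite -(bP i).2 !mxE.
  rewrite mxE => ->; under eq_bigr do rewrite crossB mulrBr -crossZr.
  rewrite sumrB -mulr_suml w1 mul1r crossB; congr (_ - _).
  rewrite /t; elim/big_rec2 : _ => [|j u v _ <-]; last by rewrite crossD.
  by rewrite /cross !mxE; ring.
have gt : dot g (t - y) = c by move: nt; rewrite nE ct mulr0 subr0.
have c0 : 0 <= c.
  have [_ [_ [_ [s Ss <-] _]]] := hull_extremes (dot_scalar n) Sy.
  by have := pS s Ss; rewrite -nS nB; lra.
have gg := dot_gt0 _ g0.
(* Otherwise [z] would lie between [y] and [t], hence in the hull. *)
have cg : c < dot g g.
  rewrite ltNge; apply/negP => gc; apply: Sz.
  have c_gt0 := lt_le_trans gg gc.
  have -> : z = (1 - dot g g / c) *: y + (dot g g / c) *: t.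
    have tE : t - y = (c / dot g g) *: g.
      apply: (inj g) => //; first by rewrite gt dotZ divfK// gt_eqF.
      by rewrite ct crossZr crossxx mulr0.
    rewrite -[t](subrK y) tE; move: gg c_gt0; move: (dot g g) => G G0 c_gt0.
    by apply: row2P; rewrite !mxE; field; rewrite !gt_eqF.
  apply: hull_segment => //.
  by rewrite divr_ge0 ?(ltW gg)//= ler_pdivrMr// mul1r.
have n0 : n != 0.
  apply/eqP => n0; have := nE g; rewrite n0 crossxx mulr0 subr0.
  rewrite (_ : dot 0 g = 0); last by rewrite /dot !mxE; ring.
  by move=> gE; move: gg; rewrite -gE ltxx.
(* Two points of the face on either side of [t], ordered so that [S] lies to the right of
   [s' - s]. *)
have [_ [_ [[s' Fs' <-] [s Fs <-] s't ts]]] := hull_extremes (cross_scalar n) Ft.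
have [Ss ns] := Fs; have [Ss' ns'] := Fs'.
pose r := c / dot g g.
pose de := cross n (embed s) - cross n (embed s').
pose ta := if de == 0 then 0 else (cross n (embed s) - cross n t) / de.
have de0 : 0 <= de by rewrite /de; lra.
have taP : 0 <= ta <= 1 /\ t = (1 - ta) *: embed s + ta *: embed s'.
  rewrite /ta; case: (eqVneq de 0) => [d0|d0].
    rewrite lexx ler01; split=> //; rewrite subr0 scale1r scale0r addr0.
    apply: (inj n) => //; first by move: nt ns; rewrite !nB; lra.
    by move: d0; rewrite /de; lra.
  have d_gt0 : 0 < de by rewrite lt_def d0.
  split.
    apply/andP; split; first by apply: divr_ge0 => //; rewrite subr_ge0.
    by rewrite ler_pdivrMr// mul1r /de lerD2l lerN2.
  apply: (inj n) => //.
    have -> x u v : dot n ((1 - x) *: u + x *: v) = (1 - x) * dot n u + x * dot n v.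
      by rewrite /dot !mxE; ring.
    move: nt ns ns'; rewrite !nB => e1 e2 e3.
    have -> : dot n t = dot n (embed s) by lra.
    have -> : dot n (embed s') = dot n (embed s) by lra.
    by ring.
  rewrite crossD !crossZr.
  by move: d0; rewrite /de => d0; field.
exists r, ta, s, s'; split.
  split=> //; [|by case: taP|].
    by rewrite /r divr_ge0 ?(ltW gg)//= ler_pdivrMr// mul1r ltW.
  case: taP => _ <-; apply: (inj g) => //.
    have -> : dot g t = c + dot g y.
      by rewrite -gt /dot !mxE; ring.
    rewrite (_ : dot g y = dot g z - dot g g); last by rewrite /g /dot !mxE; ring.
    have -> : dot g ((1 - r) *: y + r *: z) = (1 - r) * dot g y + r * dot g z.
      by rewrite /dot !mxE; ring.
    rewrite (_ : dot g y = dot g z - dot g g); last by rewrite /g /dot !mxE; ring.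
    by rewrite /r; field; rewrite gt_eqF.
  have zy : cross g z = cross g y by have := crossxx g; rewrite {2}/g crossB; lra.
  have ty : cross g t = cross g y by move: ct; rewrite crossB; lra.
  by rewrite ty crossD !crossZr zy; ring.
have [->|/eqP ss'] := eqVneq s s'; [by left|right].
have d_gt0 : 0 < de.
  rewrite lt_def de0 andbT; apply/eqP => d0; apply: ss'.
  have : embed s = embed s'.
    apply: (inj n) => //; first by move: ns ns'; rewrite !nB; lra.
    by move: d0; rewrite /de; lra.
  by move=> /rowP E; apply/rowP => i; have := E i; rewrite !mxE => /eqP; rewrite eqr_int => /eqP.
have nn := dot_gt0 _ n0.
(* Since [s' - s] is orthogonal to [n], its [cross] form is a positive multiple of [dot n]. *)
have key v : dot n n * cross (embed (s' - s)) v = de * dot n v.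
  have -> : de = - cross n (embed (s' - s)) by rewrite embedB crossB /de; ring.
  have h : dot n (embed (s' - s)) = 0 by move: ns ns'; rewrite embedB !nB; lra.
  transitivity (dot n (embed (s' - s)) * cross n v
    - cross n (embed (s' - s)) * dot n v); last by rewrite h; ring.
  by rewrite /dot /cross; ring.
split=> // [x Sx|].
  rewrite -(@ler_int R) -cross_embed -(pmulr_rle0 _ nn) key embedB pmulr_rle0//.
  by have := pS x Sx; rewrite -nS; move: ns; rewrite !nB; lra.
rewrite -(pmulr_rgt0 _ nn) key pmulr_rgt0//.
have : dot n g = dot g g by rewrite nE crossxx mulr0 subr0.
by move: ns cg; rewrite {1}/g !nB; lra.
Qed.

End Plane.

(** * Edges of one polygon that meet another *)

Section Caps.
Local Open Scope classical_set_scope.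
Local Open Scope ring_scope.
Context {R : realType}.
Local Notation embed := (@embed R 2).
Local Notation hull S := (convex_hull (embed @` S)).
Implicit Types (A Q S T : set 'rV[int]_2) (e d s a q : 'rV[int]_2).

Definition hull_closed S := convZ R S `<=` S.

(* [s, s'] is an edge of [S], with [S] on its right, that meets [hull T]. *)
Definition cap S T s s' :=
  [/\ S s, S s', s <> s', forall x, S x -> cross (s' - s) (x - s) <= 0 &
    exists2 t : R, 0 <= t <= 1 & hull T ((1 - t) *: embed s + t *: embed s')].

Lemma hull_line S s e (z1 z2 : R) (k : int) : hull_closed S ->
  z1 <= k%:~R <= z2 -> hull S (embed s + z1 *: embed e) ->
  hull S (embed s + z2 *: embed e) -> S (s + k *: e).
Proof.
move=> Scl /andP[k1 k2] h1 h2; apply: Scl; rewrite /convZ /=.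
have [z12|z12] := eqVneq z1 z2.
  rewrite embedD embedZ; have -> // : k%:~R = z1 by lra.
have zlt : 0 < z2 - z1 by rewrite subr_gt0 lt_def eq_sym z12 (le_trans k1).
have -> : embed (s + k *: e) = (1 - (k%:~R - z1) / (z2 - z1)) *: (embed s + z1 *: embed e)
    + ((k%:~R - z1) / (z2 - z1)) *: (embed s + z2 *: embed e).
  rewrite embedD embedZ; apply/rowP => i; rewrite !mxE; field.
  by rewrite gt_eqF.
apply: hull_segment => //; rewrite divr_ge0 ?subr_ge0 ?(ltW zlt)//; last first.
  by rewrite (le_trans k1).
by rewrite ler_pdivrMr// mul1r lerD2r.
Qed.

(** The points [s + k *: e] of the edge belong to [S], hence not to the hull of [T]. The section of
    that hull is convex and meets the edge, so it fits strictly between two consecutive ones. *)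
Lemma section_lt1 S T s s' e (g : int) : hull_closed S -> hull_closed T ->
  (forall x, S x -> T x -> False) -> 0 < g -> s' - s = g *: e -> cap S T s s' ->
  exists m : int, forall z : R, hull T (embed s + z *: embed e) ->
    m%:~R < z < m%:~R + 1.
Proof.
move=> Scl Tcl dis g0 ge [Ss Ss' _ _ [t /andP[t0 t1] Tt]].
have s'E : embed s' = embed s + g%:~R *: embed e.
  by rewrite -embedZ -ge embedB addrC subrK.
pose x := t * g%:~R.
have g0' : 0 < g%:~R :> R by rewrite ltr0z.
have x0 : 0 <= x by rewrite mulr_ge0// ltW.
have xg : x <= g%:~R by rewrite ler_piMl// ltW.
have {}Tt : hull T (embed s + x *: embed e).
  move: Tt; have -> // : (1 - t) *: embed s + t *: embed s' = embed s + x *: embed e.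
  by rewrite s'E; apply/rowP => i; rewrite !mxE /x; ring.
have latS k : 0 <= k <= g -> S (s + k *: e).
  move=> /andP[k0 kg]; apply: (@hull_line S s e 0 g%:~R k) => //.
  - by rewrite ler0z ler_int k0.
  - by rewrite scale0r addr0; apply: hull_embed.
  - by rewrite -s'E; apply: hull_embed.
pose m := Num.floor x; exists m.
have mx : m%:~R <= x by exact: floor_le.
have xm : x < m%:~R + 1 by have := floorD1_gt x; rewrite rmorphD.
have m0 : 0 <= m by rewrite floor_ge0.
have mg : m <= g by rewrite -(@ler_int R) (le_trans mx).
have Sm : S (s + m *: e) by apply: latS; rewrite m0.
(* The common point [x] is not a lattice point, so [m + 1] still lies on the edge. *)
have mltx : m%:~R < x.
  rewrite lt_neqAle mx andbT; apply/eqP => mE; apply: (dis _ Sm).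
  by apply: (@hull_line T s e x x m) => //; rewrite mE lexx.
have Sm1 : S (s + (m + 1) *: e).
  apply: latS; rewrite addr_ge0//= lezD1 -(@ltr_int R).
  exact: lt_le_trans mltx xg.
move=> z Tz; apply/andP; split.
  rewrite ltNge; apply/negP => zm; apply: (dis _ Sm).
  by apply: (@hull_line T s e z x m) => //; rewrite zm mx.
rewrite ltNge; apply/negP => zm; apply: (dis _ Sm1).
by apply: (@hull_line T s e x z (m + 1)) => //; rewrite rmorphD/= zm ltW.
Qed.

(* [T] has an edge at the opposite side of every edge of [S]. *)
Definition opposite_edges S T := forall d,
  (exists q q', [/\ S q, S q', q <> q' &
     forall x, S x -> cross d x <= cross d q /\ cross d x <= cross d q']) ->
  exists a a', [/\ T a, T a', a <> a' &
     forall x, T x -> cross d a <= cross d x /\ cross d a' <= cross d x].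

(** Two lattice points of the opposite edge differ by a nonzero multiple of [e]; by convexity one
    full step already lies in [T]. *)
Lemma opposite_edge_primitive S T s s' e (g : int) : hull_closed T ->
  opposite_edges S T -> 0 < g -> primitive e -> s' - s = g *: e ->
  cap S T s s' ->
  exists a, [/\ T a, T (a + e) & forall x, T x -> cross e a <= cross e x].
Proof.
move=> Tcl opp g0 [k ke] ge [Ss Ss' ss' sup _].
have ge' x y : cross (g *: e) x <= cross (g *: e) y -> cross e x <= cross e y.
  by rewrite !crossZl ler_pM2l.
have [|a [a' [Ta Ta' aa' min]]] := opp (s' - s).
  exists s, s'; split=> // x Sx; have := sup x Sx; rewrite crossB.
  by have := crossxx (s' - s); rewrite crossB; lia.
have key b b' : T b -> T b' -> b <> b' ->
    (forall x, T x -> cross (s' - s) b <= cross (s' - s) x) ->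
    (forall x, T x -> cross (s' - s) b' <= cross (s' - s) x) ->
    0 <= k.1 * (b' - b) 0 0 + k.2 * (b' - b) 0 1 ->
    exists a, [/\ T a, T (a + e) & forall x, T x -> cross e a <= cross e x].
  move=> Tb Tb' bb' minb minb' l0; exists b; split=> //.
    have e0 : cross e (b' - b) = 0.
      have h1 := minb _ Tb'; have h2 := minb' _ Tb; move: h1 h2.
      by rewrite ge => /ge' h1 /ge' h2; rewrite crossB; lia.
    have := collinear_multiple ke e0; set l := (X in _ = X *: _); rewrite -/l in l0 *; move=> lE.
    have l1 : 1 <= l.
      rewrite -[1]add0r lezD1 lt_def l0 andbT; apply/eqP => l_eq0; apply: bb'.
      by move: lE; rewrite l_eq0 scale0r => /eqP; rewrite subr_eq0 => /eqP.
    rewrite -[e]scale1r; apply: (@hull_line T b e 0 l%:~R 1) => //.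
    - by rewrite ler01 -(rmorph1 intr) ler_int.
    - by rewrite scale0r addr0; apply: hull_embed.
    - by rewrite -embedZ -embedD -lE addrC subrK; apply: hull_embed.
  by move=> x Tx; apply: ge'; rewrite -ge; exact: minb.
have m1 x Tx := (min x Tx).1; have m2 x Tx := (min x Tx).2.
case: (lerP 0 (k.1 * (a' - a) 0 0 + k.2 * (a' - a) 0 1)) => l0.
  exact: (key a a').
apply: (key a' a) => //; first by move=> /esym.
rewrite -oppr_le0 (_ : - _ = k.1 * (a' - a) 0 0 + k.2 * (a' - a) 0 1) ?ltW//.
by rewrite !mxE; ring.
Qed.

(** [r x y] is the parameter at which the segment from [x] to [y] crosses the line of the cap. Both
    crossings lie in the section of the hull of [T], which is shorter than one step. *)
Lemma cap_gap T s e (m : int) b1 b1' b2 b2' : primitive e ->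
  (forall z : R, hull T (embed s + z *: embed e) -> m%:~R < z < m%:~R + 1) ->
  T b1 -> T b1' -> T b2 -> T b2' ->
  cross e (b1 - s) < 0 -> cross e (b1' - s) < 0 ->
  0 < cross e (b2 - s) -> 0 < cross e (b2' - s) ->
  let r (x y : 'rV[int]_2) : R := (cross e (s - x))%:~R / (cross e (y - x))%:~R in
  exists2 z : R, `|z| < 1 &
    (1 - r b1' b2') *: embed b1' + r b1' b2' *: embed b2' =
    (1 - r b1 b2) *: embed b1 + r b1 b2 *: embed b2 + z *: embed e.
Proof.
move=> pe Tsec T1 T1' T2 T2' n1 n1' p2 p2' r.
have key x y : T x -> T y -> cross e (x - s) < 0 -> 0 < cross e (y - s) ->
    exists2 z : R, m%:~R < z < m%:~R + 1 &
    (1 - r x y) *: embed x + r x y *: embed y = embed s + z *: embed e.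
  move=> Tx Ty nx py.
  have sx0 : 0 < (cross e (s - x))%:~R :> R by rewrite ltr0z; move: nx; rewrite !crossB; lia.
  have yx0 : 0 < (cross e (y - x))%:~R :> R.
    by rewrite ltr0z; move: nx py; rewrite !crossB; lia.
  have [|z zE] := @primitive_line R e s ((1 - r x y) *: embed x + r x y *: embed y) pe.
    rewrite crossB crossD !crossZr !cross_embed /r.
    have e1 : (cross e (s - x))%:~R = (cross e s)%:~R - (cross e x)%:~R :> R.
      by rewrite crossB rmorphB.
    have e2 : (cross e (y - x))%:~R = (cross e y)%:~R - (cross e x)%:~R :> R.
      by rewrite crossB rmorphB.
    by move: yx0; rewrite e1 e2 => yx0; field; rewrite gt_eqF.
  exists z => //; apply: Tsec; rewrite -zE; apply: hull_segment.
  - rewrite /r divr_ge0 ?(ltW sx0) ?(ltW yx0)// ler_pdivrMr// mul1r ler_int.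
    by move: nx py; rewrite !crossB; lia.
  - exact: hull_embed.
  - exact: hull_embed.
have [z zm ->] := key _ _ T1 T2 n1 p2.
have [z' zm' ->] := key _ _ T1' T2' n1' p2'.
exists (z' - z); last by rewrite -addrA -scalerDl (addrC z) subrK.
rewrite ltr_norml; lra.
Qed.

(** The right side minus the left is a positive multiple of [alpha + beta - x]. *)
Lemma crossing_growth (alpha beta x d : R) : 0 < alpha -> 0 < beta -> 0 < d ->
  alpha / (alpha + beta) * x < alpha / (alpha + (beta + d)) * (x + d) ->
  x < alpha + beta.
Proof.
move=> a0 b0 d0; rewrite -subr_gt0.
have -> : alpha / (alpha + (beta + d)) * (x + d) - alpha / (alpha + beta) * x =
    alpha * d / ((alpha + beta) * (alpha + (beta + d))) * (alpha + beta - x).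
  by field; rewrite !gt_eqF// !addr_gt0.
by rewrite pmulr_rgt0 ?subr_gt0// divr_gt0// ?mulr_gt0// !addr_gt0.
Qed.

(* On the line of the first cap the segments [b1, b2] and [b1', b2'] are less
   than one step apart, and on the parallel line through [b1] exactly one step;
   the same holds for the second cap and [b2]. So the slopes of the two segments
   compare in two contradictory ways. *)
Lemma two_caps_transversal T s1 e1 s2 e2 (m1 m2 dl : int) b1 b1' b2 b2' :
  primitive e1 -> primitive e2 ->
  (forall z : R, hull T (embed s1 + z *: embed e1) -> m1%:~R < z < m1%:~R + 1) ->
  (forall z : R, hull T (embed s2 + z *: embed e2) -> m2%:~R < z < m2%:~R + 1) ->
  T b1 -> T b1' -> T b2 -> T b2' -> 0 < dl -> dl = `|cross e2 e1| ->
  cross e1 (b1 - s1) < 0 -> cross e1 (b1' - s1) = cross e1 (b1 - s1) ->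
  cross e2 (b2 - s2) < 0 -> cross e2 (b2' - s2) = cross e2 (b2 - s2) ->
  0 < cross e2 (b1 - s2) -> cross e2 (b1' - s2) = cross e2 (b1 - s2) + dl ->
  0 < cross e1 (b2 - s1) -> cross e1 (b2' - s1) = cross e1 (b2 - s1) + dl ->
  False.
Proof.
move=> pe1 pe2 sec1 sec2 T1 T1' T2 T2' dl0 dlE n1 n1' n2 n2' p1 p1' p2 p2'.
(* [al] and [c] are the distances of [b1] and [b2] from the first line, [be] and [b] those of [b2]
   and [b1] from the second, measured by the [cross] forms. *)
pose al : R := (cross e1 (s1 - b1))%:~R; pose be : R := (cross e2 (s2 - b2))%:~R.
pose b : R := (cross e2 (b1 - s2))%:~R; pose c : R := (cross e1 (b2 - s1))%:~R.
pose d : R := dl%:~R.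
have al0 : 0 < al by rewrite ltr0z; move: n1; rewrite !crossB; lia.
have be0 : 0 < be by rewrite ltr0z; move: n2; rewrite !crossB; lia.
have b0 : 0 < b by rewrite ltr0z.
have c0 : 0 < c by rewrite ltr0z.
have d0 : 0 < d by rewrite ltr0z.
have normd (z : R) (D : int) : `|D| = dl -> `|z| < 1 -> z * D%:~R < d.
  move=> DE z1; apply: le_lt_trans (ler_norm _) _.
  by rewrite normrM -intr_norm DE -[ltRHS]mul1r ltr_pM2r.
have [z z1 zE] := cap_gap pe1 sec1 T1 T1' T2 T2' n1 ltac:(by rewrite n1') p2
  ltac:(by rewrite p2' addr_gt0).
have [w w1 wE] := cap_gap pe2 sec2 T2 T2' T1 T1' n2 ltac:(by rewrite n2') p1
  ltac:(by rewrite p1' addr_gt0).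
have i1 : (cross e1 (b2 - b1))%:~R = al + c :> R.
  by rewrite -rmorphD; congr _%:~R; rewrite !crossB; lia.
have i1' : (cross e1 (b2' - b1'))%:~R = al + (c + d) :> R.
  by rewrite -!rmorphD; congr _%:~R; move: n1' p2'; rewrite !crossB; lia.
have i1'' : (cross e1 (s1 - b1'))%:~R = al :> R.
  by congr _%:~R; move: n1'; rewrite !crossB; lia.
have i2 : (cross e2 (b1 - b2))%:~R = be + b :> R.
  by rewrite -rmorphD; congr _%:~R; rewrite !crossB; lia.
have i2' : (cross e2 (b1' - b2'))%:~R = be + (b + d) :> R.
  by rewrite -!rmorphD; congr _%:~R; move: n2' p1'; rewrite !crossB; lia.
have i2'' : (cross e2 (s2 - b2'))%:~R = be :> R.
  by congr _%:~R; move: n2'; rewrite !crossB; lia.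
move: zE wE; rewrite i1 i1' i1'' i2 i2' i2'' -/al -/be => zE wE.
have valb2 : (cross e2 b2)%:~R = (cross e2 s2)%:~R - be :> R.
  by rewrite -rmorphB; congr _%:~R; rewrite crossB; lia.
have valb2' : (cross e2 b2')%:~R = (cross e2 s2)%:~R - be :> R.
  by rewrite -rmorphB; congr _%:~R; move: n2'; rewrite !crossB; lia.
have valb1 : (cross e2 b1)%:~R = (cross e2 s2)%:~R + b :> R.
  by rewrite -rmorphD; congr _%:~R; rewrite crossB; lia.
have valb1' : (cross e2 b1')%:~R = (cross e2 s2)%:~R + (b + d) :> R.
  by rewrite -!rmorphD; congr _%:~R; move: p1'; rewrite !crossB; lia.
have vala1 : (cross e1 b1)%:~R = (cross e1 s1)%:~R - al :> R.
  by rewrite -rmorphB; congr _%:~R; rewrite crossB; lia.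
have vala1' : (cross e1 b1')%:~R = (cross e1 s1)%:~R - al :> R.
  by rewrite -rmorphB; congr _%:~R; move: n1'; rewrite !crossB; lia.
have vala2 : (cross e1 b2)%:~R = (cross e1 s1)%:~R + c :> R.
  by rewrite -rmorphD; congr _%:~R; rewrite crossB; lia.
have vala2' : (cross e1 b2')%:~R = (cross e1 s1)%:~R + (c + d) :> R.
  by rewrite -!rmorphD; congr _%:~R; move: p2'; rewrite !crossB; lia.
(* The form of [e2] separates the two crossings of the first line by [z * cross e2 e1], which is
   less than [d]. *)
have X : be + b < al + c.
  apply: (crossing_growth al0 c0 d0).
  have := congr1 (cross (embed e2)) zE.
  rewrite !crossD !crossZr !cross_embed valb1 valb1' valb2 valb2'.
  have := normd z _ (esym dlE) z1; lra.
have Y : al + c < be + b.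
  apply: (crossing_growth be0 b0 d0).
  have := congr1 (cross (embed e1)) wE.
  rewrite !crossD !crossZr !cross_embed vala1 vala1' vala2 vala2'.
  have := normd w (cross e1 e2) _ w1; rewrite crossC normrN -dlE => /(_ erefl); lra.
by have := lt_trans X Y; rewrite ltxx.
Qed.

(** Otherwise each cap has a segment of [T], one primitive step long, strictly inside its own line,
    and strictly outside the line of the other cap. The cases are transversal lines, equal
    directions and opposite directions. *)
Lemma two_caps S T s1 s1' s2 s2' : hull_closed S -> hull_closed T ->
  (forall x, S x -> T x -> False) -> opposite_edges S T ->
  cap S T s1 s1' -> cap S T s2 s2' ->
  exists a, [/\ T a, cross (s1' - s1) (a - s1) <= 0 & cross (s2' - s2) (a - s2) <= 0].
Proof.
move=> Scl Tcl dis opp cap1 cap2; apply: contrapT => no.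
have prim s s' : cap S T s s' -> exists (g : int) e,
    [/\ 0 < g, primitive e & s' - s = g *: e].
  case=> _ _ ss' _ _; apply: primitive_decomposition.
  by rewrite subr_eq0; apply/eqP => e; apply: ss'.
have [g1 [e1 [g10 pe1 ge1]]] := prim _ _ cap1.
have [g2 [e2 [g20 pe2 ge2]]] := prim _ _ cap2.
have [m1 sec1] := section_lt1 Scl Tcl dis g10 ge1 cap1.
have [m2 sec2] := section_lt1 Scl Tcl dis g20 ge2 cap2.
have low s s' e (g m : int) : 0 < g -> s' - s = g *: e -> primitive e -> cap S T s s' ->
    (forall z : R, hull T (embed s + z *: embed e) -> m%:~R < z < m%:~R + 1) ->
    exists a, [/\ T a, T (a + e) & cross e (a - s) < 0].
  move=> g0 ge pe cp sec.
  have [a [Ta Tae amin]] := opposite_edge_primitive Tcl opp g0 pe ge cp.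
  exists a; split=> //; rewrite lt_neqAle; apply/andP; split.
    apply/eqP => a0; have [k ke] := pe.
    have := collinear_multiple ke a0; set l := (X in _ = X *: _) => lE.
    have := sec l%:~R; rewrite -embedZ -lE embedB addrC subrK => /(_ (hull_embed Ta)).
    by rewrite ltr_int -[1]/(1%:~R) -rmorphD ltr_int; lia.
  have [_ _ _ _ [t _ Tt]] := cp.
  have [_ [_ [[b Tb <-] _ bt _]]] := hull_extremes (cross_scalar (embed e)) Tt.
  have tE : cross (embed e) ((1 - t) *: embed s + t *: embed s') = (cross e s)%:~R.
    have /eqP : cross e (s' - s) = 0 by rewrite ge crossZr crossxx mulr0.
    rewrite crossB subr_eq0 => /eqP es.
    by rewrite crossD !crossZr !cross_embed es; ring.
  move: bt; rewrite tE cross_embed ler_int crossB => bt.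
  by have := amin b Tb; lia.
have [a1 [Ta1 Ta1e n1]] := low _ _ _ _ _ g10 ge1 pe1 cap1 sec1.
have [a2 [Ta2 Ta2e n2]] := low _ _ _ _ _ g20 ge2 pe2 cap2 sec2.
have high1 a : T a -> cross e1 (a - s1) <= 0 -> 0 < cross e2 (a - s2).
  move=> Ta a1n; rewrite ltNge; apply/negP => a2n; apply: no; exists a; split=> //.
  - by rewrite ge1 crossZl pmulr_rle0.
  - by rewrite ge2 crossZl pmulr_rle0.
have high2 a : T a -> cross e2 (a - s2) <= 0 -> 0 < cross e1 (a - s1).
  by move=> Ta a2n; rewrite ltNge; apply/negP => /(high1 _ Ta); rewrite ltNge a2n.
have shift e s a : cross e (a + e - s) = cross e (a - s).
  by rewrite !crossB crossD crossxx addr0.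
have n1' : cross e1 (a1 + e1 - s1) < 0 by rewrite shift.
have n2' : cross e2 (a2 + e2 - s2) < 0 by rewrite shift.
have p1 := high1 _ Ta1 (ltW n1); have p1' := high1 _ Ta1e (ltW n1').
have p2 := high2 _ Ta2 (ltW n2); have p2' := high2 _ Ta2e (ltW n2').
have sh12 : cross e2 (a1 + e1 - s2) = cross e2 (a1 - s2) + cross e2 e1.
  by rewrite !crossB crossD; ring.
have sh21 : cross e1 (a2 + e2 - s1) = cross e1 (a2 - s1) - cross e2 e1.
  by rewrite !crossB crossD (crossC e2 e1); ring.
(* The sign tells which end of each segment is farther from the other line. *)
case: (ltrgtP (cross e2 e1) 0) => D0.
- apply: (@two_caps_transversal T s1 e1 s2 e2 m1 m2 (- cross e2 e1)
    (a1 + e1) a1 a2 (a2 + e2)) => //; rewrite ?shift ?oppr_gt0//; first by rewrite ltr0_norm.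
  by rewrite sh12; ring.
- apply: (@two_caps_transversal T s1 e1 s2 e2 m1 m2 (cross e2 e1)
    a1 (a1 + e1) (a2 + e2) a2) => //; rewrite ?shift//; first by rewrite gtr0_norm.
  by rewrite sh21; ring.
have [k2 k2e] := pe2; have [k1 k1e] := pe1.
have e12 := collinear_multiple k2e D0; set k := (X in _ = X *: _) in e12.
have e21 : cross e1 e2 = 0 by rewrite crossC D0 oppr0.
have := collinear_multiple k1e e21; set l := (X in _ = X *: _) => e2E.
have kl : k * l = 1.
  have : k1.1 * e1 0 0 + k1.2 * e1 0 1 = (k * l) * (k1.1 * e1 0 0 + k1.2 * e1 0 1).
    have e1E : e1 = (k * l) *: e1 by rewrite -scalerA -e2E.
    by rewrite {1 2}e1E !mxE; ring.
  by rewrite k1e mulr1.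
have : (l == 1) || (l == -1).
  have /eqP := congr1 absz kl; rewrite abszM muln_eq1 => /andP[_ /eqP l1].
  by apply/orP; case: (lerP 0 l) => l0; [left|right]; apply/eqP; lia.
case/orP=> /eqP l1; move: e2E; rewrite l1 ?scale1r ?scaleN1r => e2E.
  (* Equal directions: both lines support [S] on the same side, so they coincide and [a1] is inside
     both. *)
  have [S1 _ _ sup1 _] := cap1; have [S2 _ _ sup2 _] := cap2.
  have := sup1 _ S2; have := sup2 _ S1.
  rewrite ge1 ge2 e2E !crossZl !pmulr_rle0// => h1 h2.
  by move: p1 n1 h1 h2; rewrite e2E !crossB; lia.
(* Opposite directions: the segments from [a1] to [a2 + e2] and from [a1 + e1] to [a2] are
   translates by [e1], so they cross the line exactly one step apart. *)
have [z z1] := cap_gap pe1 sec1 Ta1 Ta1e Ta2e Ta2 n1 n1' p2' p2.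
have -> : cross e1 (a2 - (a1 + e1)) = cross e1 (a2 + e2 - a1).
  by rewrite !crossB !crossD crossxx e21; ring.
have -> : cross e1 (s1 - (a1 + e1)) = cross e1 (s1 - a1).
  by rewrite !crossB crossD crossxx addr0.
set r := _ / _ => zE.
have : embed e1 = z *: embed e1.
  apply: (addrI ((1 - r) *: embed a1 + r *: embed (a2 + e2))); rewrite -zE e2E.
  rewrite !embedD; apply/rowP => i; rewrite !mxE rmorphN/=; ring.
move=> e1z; have : k1.1%:~R * embed e1 0 0 + k1.2%:~R * embed e1 0 1 =
    z * (k1.1%:~R * embed e1 0 0 + k1.2%:~R * embed e1 0 1).
  by rewrite {1 2}e1z !mxE; ring.
rewrite !mxE -!rmorphM -rmorphD k1e mulr1 => z_eq1.
by move: z1; rewrite -z_eq1 normr1 ltxx.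
Qed.

End Caps.

(** * Lattice points of Minkowski sums of polygons *)

Section Polygons.
Local Open Scope classical_set_scope.
Local Open Scope ring_scope.
Context {R : realType}.
Local Notation embed := (@embed R 2).
Local Notation hull S := (convex_hull (embed @` S)).
Local Notation closed := (@hull_closed R).
Local Notation edge := (@cap R).
Implicit Types (A Q S T : set 'rV[int]_2) (d s a q : 'rV[int]_2).

Lemma card_le2_sub (I : finType) (X : {set I}) i0 : (#|X| <= 2)%N -> i0 \in X ->
  exists i1, forall i, i \in X -> i = i0 \/ i = i1.
Proof.
move=> X2 i0X.
have : (#|X :\ i0| <= 1)%N by move: X2; rewrite (cardsD1 i0) i0X.
move/card_le1_eqP => X1.
have [[i1 i1X]|no] := pselect (exists i1, i1 \in (X :\ i0)%SET).
  exists i1 => i iX; have [->|ne] := eqVneq i i0; [by left|right].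
  by apply: X1 => //; rewrite !inE ne.
exists i0 => i iX; left; apply/eqP/negPn/negP => ne.
by apply: no; exists i; rewrite !inE ne.
Qed.

Lemma cap_meets S T s s' : edge S T s s' ->
  exists2 a, T a & cross (s' - s) (a - s) <= 0.
Proof.
move=> [_ _ _ _ [t _ Tt]].
have [_ [_ [[a Ta <-] _ + _]]] := hull_extremes (cross_scalar (embed (s' - s))) Tt.
move=> h; exists a => //; rewrite crossB subr_le0 -(@ler_int R) -!cross_embed.
apply: le_trans h _; rewrite le_eqVlt; apply/orP; left; apply/eqP.
have /eqP : cross (embed (s' - s)) (embed s' - embed s) = 0 by rewrite -embedB crossxx.
rewrite crossB subr_eq0 => /eqP ss'.
by rewrite crossD !crossZr ss'; ring.
Qed.

(* Here [r] and [q] are the times at which the segment from [y] to [z] leaves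
   [S] and [T]. *)
Lemma exit_cap S T (y z : 'rV[R]_2) (r q : R) s s' t : closed T ->
  (forall x, S x -> T x -> False) -> hull T y ->
  0 <= r <= q -> 0 <= t <= 1 -> S s -> S s' ->
  hull T ((1 - q) *: y + q *: z) ->
  (1 - r) *: y + r *: z = (1 - t) *: embed s + t *: embed s' ->
  (s = s' \/ [/\ s <> s', forall x, S x -> cross (s' - s) (x - s) <= 0 &
       0 < cross (embed (s' - s)) (z - embed s)]) ->
  edge S T s s' /\ 0 < cross (embed (s' - s)) (z - embed s).
Proof.
move=> Tcl dis Ty /andP[r0 rq] t01 Ss Ss' Tq rt.
have Tr : hull T ((1 - t) *: embed s + t *: embed s').
  rewrite -rt; have [q0|q0] := eqVneq q 0.
    by have -> : r = 0 by [move: rq; rewrite q0 => ?; lra]; rewrite subr0 scale1r scale0r addr0.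
  have q_gt0 : 0 < q by rewrite lt_def q0 (le_trans r0).
  have -> : (1 - r) *: y + r *: z = (1 - r / q) *: y + (r / q) *: ((1 - q) *: y + q *: z).
    by apply/rowP => i; rewrite !mxE; field.
  apply: hull_segment => //; apply/andP; split; first by rewrite divr_ge0 ?(ltW q_gt0).
  by rewrite ler_pdivrMr// mul1r.
case=> [ss'|[ss' sup pos]].
  case: (dis s Ss); apply: Tcl; rewrite /convZ /=.
  by move: Tr; rewrite -ss' -scalerDl subrK scale1r.
by split=> //; split=> //; exists t.
Qed.

Theorem lattice_point_of_meeting_hulls A Q (y : 'rV[R]_2) :
  finite_set A -> finite_set Q -> closed A -> closed Q ->
  opposite_edges Q A -> hull A y -> hull Q y -> exists2 x, A x & Q x.
Proof.
move=> finA finQ Acl Qcl opp Ay Qy; apply: contrapT => no.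
have dis x : A x -> Q x -> False by move=> Ax Qx; apply: no; exists x.
have dis' x : Q x -> A x -> False by move=> Qx Ax; exact: dis Ax Qx.
have /finite_seqP[lA lAE] := finA; have /finite_seqP[lQ lQE] := finQ.
pose IQ := ('I_(size lQ) * 'I_(size lQ))%type.
pose IA := ('I_(size lA) * 'I_(size lA))%type.
pose pQ (i : IQ) := (tnth (in_tuple lQ) i.1, tnth (in_tuple lQ) i.2).
pose pA (i : IA) := (tnth (in_tuple lA) i.1, tnth (in_tuple lA) i.2).
pose good (i : IQ + IA) := match i with
  | inl i => edge Q A (pQ i).1 (pQ i).2
  | inr i => edge A Q (pA i).1 (pA i).2 end.
pose p (i : IQ + IA) := match i with inl i => pQ i | inr i => pA i end.
(* All pairs of points serve as indices; for a pair that is not a cap, [d i = 0] gives a constraint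
   that always holds. *)
pose d i := if `[< good i >] then (p i).2 - (p i).1 else 0.
pose c i := cross (d i) (p i).1.
have viol i z : c i < cross (d i) z -> good i /\
    0 < cross ((p i).2 - (p i).1) (z - (p i).1).
  rewrite /c /d; case: asboolP => [gi|_]; first by rewrite crossB subr_gt0.
  by rewrite /cross !mxE !mul0r ltxx.
have violE i z : good i -> 0 < cross ((p i).2 - (p i).1) (z - (p i).1) ->
    c i < cross (d i) z.
  by move=> gi; rewrite /c /d; case: asboolP => // _; rewrite crossB subr_gt0.
have idxQ s s' : Q s -> Q s' -> exists i : IQ, pQ i = (s, s').
  rewrite lQE /= => /(@tnthP _ _ (in_tuple lQ))[i ->] /(@tnthP _ _ (in_tuple lQ))[j ->].
  by exists (i, j).
have idxA s s' : A s -> A s' -> exists i : IA, pA i = (s, s').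
  rewrite lAE /= => /(@tnthP _ _ (in_tuple lA))[i ->] /(@tnthP _ _ (in_tuple lA))[j ->].
  by exists (i, j).
(* On the way from [y] to [z], the polygon that is left first is left through an edge meeting the
   other one, so [z] violates the half-plane of a cap. *)
have infeasible z : exists i, c i < cross (d i) z.
  have violQ s s' : edge Q A s s' -> 0 < cross (embed (s' - s)) (embed z - embed s) ->
      exists i, c i < cross (d i) z.
    move=> cp pos; have [i iE] := idxQ s s' ltac:(by case: cp) ltac:(by case: cp).
    exists (inl i); apply: violE; rewrite /good /p iE//=.
    by move: pos; rewrite -embedB cross_embed ltr0z.
  have violA s s' : edge A Q s s' -> 0 < cross (embed (s' - s)) (embed z - embed s) ->
      exists i, c i < cross (d i) z.
    move=> cp pos; have [i iE] := idxA s s' ltac:(by case: cp) ltac:(by case: cp).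
    exists (inr i); apply: violE; rewrite /good /p iE//=.
    by move: pos; rewrite -embedB cross_embed ltr0z.
  have at1 : embed z = (1 - 1) *: y + 1 *: embed z by rewrite subrr scale0r add0r scale1r.
  have [Az|Az] := pselect (A z).
    have Qz : ~ hull Q (embed z) by move=> /Qcl; exact: dis.
    have [r [t [s [s' [[r1 t1 Qs Qs' e] ex]]]]] := exit_edge finQ Qy Qz.
    have [|cp pos] := exit_cap Acl dis' Ay r1 t1 Qs Qs' _ e ex; last exact: violQ cp pos.
    by rewrite -at1; apply: hull_embed.
  have {}Az : ~ hull A (embed z) by move=> /Acl.
  have [r [t [s [s' [[r1 t1 As As' e] ex]]]]] := exit_edge finA Ay Az.
  have [Qz|Qz] := pselect (Q z).
    have [|cp pos] := exit_cap Qcl dis Qy r1 t1 As As' _ e ex; last exact: violA cp pos.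
    by rewrite -at1; apply: hull_embed.
  have {}Qz : ~ hull Q (embed z) by move=> /Qcl.
  have [q [t' [w [w' [[q1 t'1 Qw Qw' e'] ex']]]]] := exit_edge finQ Qy Qz.
  have [r0 _] := andP r1; have [q0 _] := andP q1.
  case: (lerP r q) => rq.
    have [||cp pos] := @exit_cap A Q y (embed z) r q s s' t Qcl dis Qy _ t1 As As' _ e ex;
      last exact: violA cp pos.
    - by rewrite r0; exact: rq.
    - by rewrite e'; apply: hull_segment => //; apply: hull_embed.
  have [||cp pos] := @exit_cap Q A y (embed z) q r w w' t' Acl dis' Ay _ t'1 Qw Qw' _ e' ex';
    last exact: violQ cp pos.
  - by rewrite q0; exact: ltW rq.
  - by rewrite e; apply: hull_segment => //; apply: hull_embed.
have [B [B4 BP]] := doignon infeasible.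
have a0 : exists a, A a.
  by have [_ [_ [[a Aa _] _ _ _]]] := hull_extremes (cross_scalar (0 : 'rV[R]_2)) Ay; exists a.
have q0 : exists q, Q q.
  by have [_ [_ [[q Qq _] _ _ _]]] := hull_extremes (cross_scalar (0 : 'rV[R]_2)) Qy; exists q.
have onQ i x : good (inl i) -> Q x -> cross ((pQ i).2 - (pQ i).1) (x - (pQ i).1) <= 0.
  by move=> [_ _ _ sup _]; exact: sup.
have onA i x : good (inr i) -> A x -> cross ((pA i).2 - (pA i).1) (x - (pA i).1) <= 0.
  by move=> [_ _ _ sup _]; exact: sup.
pose isQ (i : IQ + IA) := if i is inl _ then true else false.
pose BQ := (B :&: [set i | isQ i])%SET; pose BA := (B :\: [set i | isQ i])%SET.
have Bcard : (#|BQ| + #|BA| <= 4)%N by rewrite cardsID.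
(* Points of [Q] satisfy all constraints from [Q], so only those from [A] matter for them, and
   conversely. *)
case: (leqP #|BA| 1) => [BA1|BA2].
  have [q Qq qP] : exists2 q, Q q & forall j, inr j \in B -> good (inr j) ->
      cross ((pA j).2 - (pA j).1) (q - (pA j).1) <= 0.
    have [[j [jB gj]]|noj] := pselect (exists j, inr j \in B /\ good (inr j)).
      have [q Qq qj] := cap_meets gj; exists q => // j' j'B _.
      have /card_le1_eqP/(_ (inr j) (inr j')) := BA1.
      by rewrite !inE/= => /(_ jB j'B)[->].
    have [q Qq] := q0; exists q => // j jB gj; case: noj; by exists j.
  have [[i|j] iB /viol[gi]] := BP q; rewrite ltNge; first by rewrite onQ.
  by rewrite qP.
have BQ2 : (#|BQ| <= 2)%N by lia.
have [a Aa aP] : exists2 a, A a & forall i, inl i \in B -> good (inl i) ->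
    cross ((pQ i).2 - (pQ i).1) (a - (pQ i).1) <= 0.
  have [[i0 [i0B gi0]]|noi] := pselect (exists i, inl i \in B /\ good (inl i)).
    have i0BQ : inl i0 \in BQ by rewrite !inE i0B.
    have [i1 i1P] := card_le2_sub BQ2 i0BQ.
    have [[k [kB gk]]|nok] := pselect (exists k, inl k = i1 /\ good (inl k)).
      have [a [Aa a1 a2]] := two_caps Qcl Acl dis' opp gi0 gk.
      exists a => // i iB gi; have := i1P (inl i); rewrite !inE iB => /(_ isT)[[->]//|].
      by rewrite -kB => -[->].
    have [a Aa a1] := cap_meets gi0; exists a => // i iB gi.
    have := i1P (inl i); rewrite !inE iB => /(_ isT)[[->]//|ii1].
    by case: nok; exists i.
  have [a Aa] := a0; exists a => // i iB gi; case: noi; by exists i.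
have [[i|j] iB /viol[gi]] := BP a; rewrite ltNge; first by rewrite aP.
by rewrite onA.
Qed.

Definition minkowski S T : set 'rV[int]_2 := [set s + t | s in S & t in T].

(* Every edge direction of [Q] is, with the same outer normal, an edge
   direction of [P]: the normal fan of [P] refines that of [Q]. *)
Definition edges_refine Q P := forall d,
  (exists q q', [/\ Q q, Q q', q <> q' &
     forall x, Q x -> cross d x <= cross d q /\ cross d x <= cross d q']) ->
  exists a a', [/\ P a, P a', a <> a' &
     forall x, P x -> cross d x <= cross d a /\ cross d x <= cross d a'].

Lemma hull_minkowski S T (x : 'rV[R]_2) : hull (minkowski S T) x ->
  exists y z, [/\ hull S y, hull T z & x = y + z].
Proof.
apply: (@hull_ind _ _ _ (fun x => exists y z,
  [/\ hull S y, hull T z & x = y + z])) => [_ [_ [s Ss [t Tt <-]] <-]|x1 x2 r r01].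
  by exists (embed s), (embed t); rewrite embedD; split=> //; exact: hull_embed.
move=> [y1 [z1 [Sy1 Tz1 ->]]] [y2 [z2 [Sy2 Tz2 ->]]].
exists ((1 - r) *: y1 + r *: y2), ((1 - r) *: z1 + r *: z2).
by split; [exact: hull_segment|exact: hull_segment|rewrite !scalerDr addrACA].
Qed.

Lemma hull_reflect S a (y : 'rV[R]_2) : hull S y ->
  hull [set a - s | s in S] (embed a - y).
Proof.
apply: (@hull_ind _ _ _ (fun y => hull _ (embed a - y))) => [_ [s Ss <-]|x1 x2 r r01 h1 h2].
  by rewrite -embedB; apply: hull_embed; exists s.
have -> : embed a - ((1 - r) *: x1 + r *: x2) =
    (1 - r) *: (embed a - x1) + r *: (embed a - x2).
  by apply/rowP => i; rewrite !mxE; ring.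
exact: hull_segment.
Qed.

Lemma reflectK S a : [set a - t | t in [set a - s | s in S]] = S.
Proof.
apply/seteqP; split=> [_ [_ [s Ss <-] <-]|s Ss]; first by rewrite opprB addrC subrK.
by exists (a - s); [exists s|rewrite opprB addrC subrK].
Qed.

(** A decomposition of [x] is a common point of [Q] and [x - P]. The reflection reverses normals and
    so turns [edges_refine] into [opposite_edges]. *)
Theorem minkowski_hull_closed P Q : finite_set P -> finite_set Q ->
  closed P -> closed Q -> edges_refine Q P -> closed (minkowski P Q).
Proof.
move=> finP finQ Pcl Qcl ref x; rewrite /convZ /= => /hull_minkowski[y [z [Py Qz xE]]].
pose A := [set x - s | s in P].
have [|||||||_ [s Ps <-] Qx] := @lattice_point_of_meeting_hulls A Q z.
- exact: finite_image.
- exact: finQ.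
- move=> b /= /(hull_reflect x); rewrite reflectK -embedB => /Pcl xb.
  by exists (x - b) => //; rewrite opprB addrC subrK.
- exact: Qcl.
- move=> d [q [q' [Qq Qq' qq' qP]]].
  have [|a [a' [Pa Pa' aa' aP]]] := ref d; first by exists q, q'.
  exists (x - a), (x - a'); split; [by exists a|by exists a'| |].
    by move=> /(congr1 (fun w => x - w)); rewrite !opprB ![x + _]addrC !subrK.
  by move=> _ [w Pw <-]; rewrite !crossB !lerD2l !lerN2; exact: aP.
- by have := hull_reflect x Py; rewrite xE addrC addKr.
- exact: Qz.
by exists s => //; exists (x - s) => //; rewrite addrC subrK.
Qed.

End Polygons.

(** * Demand sets *)

Section Demand.
Local Open Scope classical_set_scope.
Local Open Scope ring_scope.
Context {R : realType}.

Lemma finite_argmax (T : eqType) (E : set T) (f : T -> R) : finite_set E ->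
  E !=set0 -> exists2 m, E m & forall x, E x -> f x <= f m.
Proof.
move=> /finite_seqP[l ->] [x0 /= x0l].
have /tnthP[i0 _] : x0 \in in_tuple l by [].
case: (@arg_maxP _ _ _ i0 predT (fun i => f (tnth (in_tuple l) i))) => // i _ imax.
exists (tnth (in_tuple l) i); first by rewrite /= mem_tnth.
by move=> x xl; have /tnthP[j ->] : x \in in_tuple l by []; exact: imax.
Qed.

Lemma sup_eq_max (E : set R) m : E m -> (forall x, E x -> x <= m) -> sup E = m.
Proof.
move=> Em Emax; apply/eqP; rewrite eq_le; apply/andP; split.
  by apply: ge_sup => //; exists m.
by apply: ub_le_sup => //; exists m.
Qed.

Context {n : nat}.
Local Notation embed := (@embed R n).
Implicit Types (v : valuation R n) (p w : 'rV[R]_n) (a b : 'rV[int]_n).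

Definition surplus v p a : R := value v a - dotr p (embed a).

Lemma demand_nonempty v p : exists a, demand v p a.
Proof.
have [a da amax] := finite_argmax (surplus v p) (dom_finite v) (dom_nonempty v).
by exists a.
Qed.

Lemma demand_finite v p : finite_set (demand v p).
Proof. by apply: sub_finite_set (dom_finite v) => a []. Qed.

Lemma dotrDl p q (x : 'rV[R]_n) : dotr (p + q) x = dotr p x + dotr q x.
Proof. by rewrite /dotr -big_split/=; apply: eq_bigr => i _; rewrite !mxE mulrDl. Qed.

Lemma dotrZl (k : R) p (x : 'rV[R]_n) : dotr (k *: p) x = k * dotr p x.
Proof. by rewrite /dotr mulr_sumr; apply: eq_bigr => i _; rewrite !mxE mulrA. Qed.

Lemma dotrC p (x : 'rV[R]_n) : dotr p x = dotr x p.
Proof. by apply: eq_bigr => i _; rewrite mulrC. Qed.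

Lemma dotr_embed_sum p (I : finType) (S : {set I}) (x : I -> 'rV[int]_n) :
  dotr p (embed (\sum_(j in S) x j)) = \sum_(j in S) dotr p (embed (x j)).
Proof.
elim/big_rec2 : _ => [|j y1 y2 _ <-].
  by rewrite /dotr big1 // => i _; rewrite !mxE mulr0.
by rewrite /dotr -big_split/=; apply: eq_bigr => i _; rewrite !mxE rmorphD mulrDr.
Qed.

(** The sign arises because [trop_poly] adds the pairing with [x] while [demand] subtracts the
    price. *)
Lemma trop_hypersurfaceP v p : trop_hypersurface v (- p) <->
  exists a b, [/\ a <> b, demand v p a & demand v p b].
Proof.
have valE a : value v a + dotr (embed a) (- p) = surplus v p a.
  by rewrite dotrC -scaleN1r dotrZl mulN1r.
have tropE a : demand v p a -> trop_poly v (- p) = surplus v p a.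
  move=> [da amax]; apply: sup_eq_max; first by exists a; rewrite ?valE.
  by move=> _ [b db <-]; rewrite valE; exact: amax.
have [m [dm mmax]] := demand_nonempty v p.
split=> [[a [b [ab da db]]]|[a [b [ab pa pb]]]].
  rewrite !valE (tropE m)// => ea eb; exists a, b; split=> //; split=> // x dx.
    by apply: le_trans (mmax x dx) _; rewrite -/(surplus v p a) ea.
  by apply: le_trans (mmax x dx) _; rewrite -/(surplus v p b) eb.
exists a, b; rewrite !valE -(tropE a)// -(tropE b)//.
by split=> //; [case: pa|case: pb].
Qed.

Lemma finite_small (T : eqType) (E : set T) (P : T -> R -> Prop) : finite_set E ->
  (forall s, E s -> exists2 e0, 0 < e0 & forall e, 0 < e < e0 -> P s e) ->
  exists2 e0, 0 < e0 & forall e, 0 < e < e0 -> forall s, E s -> P s e.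
Proof.
move=> /finite_seqP[l ->]; elim: l => [|s l IHl] h; first by exists 1.
have [s' s'l|e1 e1_gt0 e1P] := IHl.
  by apply: h; rewrite /= inE s'l orbT.
have [|e2 e2_gt0 e2P] := h s; first by rewrite /= inE eqxx.
exists (Num.min e1 e2); first by rewrite lt_min e1_gt0.
move=> e /andP[e0]; rewrite lt_min => /andP[ee1 ee2] s'; rewrite /= inE => /orP[/eqP ->|s'l].
  by apply: e2P; rewrite e0.
by apply: e1P => //; rewrite e0.
Qed.

(* The faces of a demand set are the demand sets at nearby prices. *)
Lemma demand_perturb v p w : exists2 e0 : R, 0 < e0 & forall e, 0 < e < e0 ->
  forall a, demand v (p - e *: w) a <->
    demand v p a /\ forall b, demand v p b -> dotr w (embed b) <= dotr w (embed a).
Proof.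
have surE e a : surplus v (p - e *: w) a = surplus v p a + e * dotr w (embed a).
  by rewrite /surplus -scaleNr dotrDl dotrZl mulNr; ring.
(* Strict preferences at [p] survive a small change of price, uniformly over the finitely many
   pairs; ties are decided by [w]. *)
have [] := @finite_small _ (dom v `*` dom v) (fun ab e => surplus v p ab.1 < surplus v p ab.2 ->
    surplus v (p - e *: w) ab.1 < surplus v (p - e *: w) ab.2).
- by apply: finite_setX; exact: dom_finite.
- move=> [a b] _ /=; have [ab|] := ltP (surplus v p a) (surplus v p b); last first.
    by exists 1 => // e _; rewrite ltNge => /negP.
  pose d := dotr w (embed a) - dotr w (embed b).
  have d0 : 0 < `|d| + 1 by rewrite ltr_wpDl.
  exists ((surplus v p b - surplus v p a) / (`|d| + 1)); first by rewrite divr_gt0// subr_gt0.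
  move=> e /andP[e0]; rewrite ltr_pdivlMr// => ed _; rewrite !surE.
  have : e * d <= e * (`|d| + 1).
    by rewrite ler_wpM2l ?(ltW e0)// (le_trans (ler_norm _))// lerDl.
  by rewrite /d; move: ed; lra.
move=> e0 e0_gt0 e0P; exists e0 => // e ee a; have e_gt0 : 0 < e by case/andP: ee.
have {}e0P x y := fun dx dy => e0P e ee (x, y) (conj dx dy).
split=> [[da amax]|[[da amax] aw]].
  have pa : demand v p a.
    split=> // b db; rewrite leNgt; apply/negP => /(e0P _ _ da db)/=.
    by rewrite ltNge; apply/negP/negPn; exact: amax.
  split=> // b [db bmax]; have := amax b db; have := bmax a da.
  rewrite -!/(surplus _ _ _) !surE => h1 h2.
  by rewrite -(ler_pM2l e_gt0); lra.
split=> // b db; rewrite -!/(surplus _ _ _).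
have [/(e0P _ _ db da)/= /ltW//|ab] := ltP (surplus v p b) (surplus v p a).
rewrite !surE; have := amax b db; rewrite -!/(surplus _ _ _) => ba.
have : e * dotr w (embed b) <= e * dotr w (embed a).
  rewrite ler_wpM2l ?(ltW e_gt0)//; apply: aw; split=> // c dc.
  exact: le_trans (amax c dc) ab.
lra.
Qed.

(** Some [s] demanded at [p] has [dotr (p - q)] at least as large as [b]. As [b] is no worse than
    [s] at [q], it is no worse at [p]. *)
Lemma demand_of_supported v p q b : demand v q b -> convZ R (demand v p) b ->
  demand v p b.
Proof.
move=> [db bmax] pb.
have [_ [_ [_ [s [ds smax] <-] _ sb]]] := hull_extremes (dotr_scalar (p - q)) pb.
split=> // x dx; apply: le_trans (smax x dx) _.
have := bmax s ds; move: sb; rewrite -scaleN1r !dotrDl !dotrZl; lra.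
Qed.

(** The region where the concave majorant reaches the affine function of maximal surplus is convex
    and contains the demand set, hence [b]; there the majorant equals the valuation. *)
Lemma concave_demand_closed v p : concave_valuation v ->
  convZ R (demand v p) `<=` demand v p.
Proof.
move=> [domE [g [[gconc gmaj] _] gE]] b bp.
have sub : demand v p `<=` dom v by move=> a [].
have hsub : convex_hull (embed @` demand v p) `<=` convex_hull (embed @` dom v).
  by apply: hull_mono; exact: image_subset.
have db : dom v b by rewrite domE; exact: hsub.
have [m [dm mmax]] := demand_nonempty v p.
pose B x := convex_hull (embed @` dom v) x /\ surplus v p m + dotr p x <= g x.
have [] : B (embed b).
  apply: (@hull_ind R n (embed @` demand v p) B _ _ _ bp) => [_ [s [ds smax] <-]|x y t t01 [dx gx] [dy gy]].
    split; first by apply: sub_hull; exists s.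
    by rewrite -gE// -lerBrDr; exact: smax.
  split; first exact: hull_segment.
  case/andP: (t01) => t0 t1.
  have [t'0 t'1] : 0 <= 1 - t /\ 1 - t <= 1 by lra.
  have := gconc (Itv01 t'0 t'1) x y (mem_set dx) (mem_set dy).
  rewrite /conv/= /conv/= (_ : unstable.onem (1 - t) = t); last exact: subKr.
  rewrite -[leRHS]/((1 - t) * - g x + t * - g y) => h.
  have -> : dotr p ((1 - t) *: x + t *: y) = (1 - t) * dotr p x + t * dotr p y.
    by rewrite dotrC dotrDl !dotrZl !(dotrC _ p).
  have h1 := ler_wpM2l t'0 gx; have h2 := ler_wpM2l t0 gy.
  move: h; lra.
move=> _ gb; split=> // x dx; apply: le_trans (mmax x dx) _.
by rewrite lerBrDr (gE b db).
Qed.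

Context {I : finType}.
Implicit Types (u : I -> valuation R n) (S : {set I}).

Lemma finite_allocation_sums (V : zmodType) u S (F : I -> 'rV[int]_n -> V) :
  finite_set [set \sum_(j in S) F j (x j) | x in allocation u S].
Proof.
have fin (s : seq I) : finite_set [set \sum_(j <- s) F j (x j) |
    x in [set x | forall j, j \in s -> dom (u j) (x j)]].
  elim: s => [|i s IHs].
    apply: (sub_finite_set _ (finite_set1 0)) => _ [x _ <-] /=.
    by rewrite big_nil.
  apply: sub_finite_set (finite_image2 +%R (finite_image (F i) (dom_finite (u i))) IHs).
  move=> _ [x xP <-]; exists (F i (x i)); first by exists (x i) => //; apply: xP; rewrite mem_head.
  exists (\sum_(j <- s) F j (x j)); last by rewrite big_cons.
  by exists x => // j js; apply: xP; rewrite in_cons js orbT.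
apply: sub_finite_set (fin (enum S)) => _ [x xP <-].
by exists x => [j|]; [rewrite mem_enum; exact: xP | rewrite big_enum].
Qed.

Lemma aggregate_val_max u S a : aggregate_dom u S a ->
  exists x, [/\ allocation u S x, \sum_(j in S) x j = a,
    aggregate_val u S a = \sum_(j in S) value (u j) (x j) &
    forall y, allocation u S y -> \sum_(j in S) y j = a ->
      \sum_(j in S) value (u j) (y j) <= aggregate_val u S a].
Proof.
move=> [x0 x0P x0a]; set E := [set \sum_(j in S) value (u j) (x j)
  | x in allocation u S `&` [set x | \sum_(j in S) x j = a]].
have finE : finite_set E.
  apply: sub_finite_set (finite_allocation_sums u S (fun j => value (u j))).
  by move=> _ [x [xP _] <-]; exists x.
have [|_ [x [xP xa] <-] xmax] := finite_argmax id finE.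
  by exists (\sum_(j in S) value (u j) (x0 j)), x0.
have supE : aggregate_val u S a = \sum_(j in S) value (u j) (x j).
  by apply: sup_eq_max => //; exists x.
exists x; split=> // y yP ya; rewrite supE; apply: xmax.
by exists y.
Qed.

Lemma surplus_sum u S p (x : I -> 'rV[int]_n) :
  \sum_(j in S) surplus (u j) p (x j) =
  \sum_(j in S) value (u j) (x j) - dotr p (embed (\sum_(j in S) x j)).
Proof. by rewrite dotr_embed_sum -sumrB. Qed.

(** The aggregate surplus is the maximum over allocations of a sum of individual surpluses, which is
    maximised agent by agent. *)
Lemma demand_aggregateP u S p a : demand (aggregate u S) p a <->
  exists2 x, (forall j, j \in S -> demand (u j) p (x j)) & a = \sum_(j in S) x j.
Proof.
have ge x : allocation u S x -> \sum_(j in S) surplus (u j) p (x j) <=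
    surplus (aggregate u S) p (\sum_(j in S) x j).
  move=> xP; have [|y [_ _ _ ymax]] := @aggregate_val_max u S (\sum_(j in S) x j); first by exists x.
  by rewrite surplus_sum lerB// ymax.
have attained b : aggregate_dom u S b -> exists x, [/\ allocation u S x,
    \sum_(j in S) x j = b &
    surplus (aggregate u S) p b = \sum_(j in S) surplus (u j) p (x j)].
  by move=> /aggregate_val_max[x [xP <- vx _]]; exists x; split=> //; rewrite surplus_sum -vx.
split=> [[da amax]|[x xP ->]].
  have [x [xP xa sx]] := attained a da.
  exists x => // j jS; split=> [|b db]; first exact: xP.
  pose y i := if i == j then b else x i.
  have yP : allocation u S y.
    by move=> i iS; rewrite /y; case: eqP => [->|_]; [|exact: xP].
  have := amax (\sum_(j in S) y j) (ex_intro2 _ _ y yP erefl).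
  rewrite -!/(surplus _ _ _) sx => h; have := le_trans (ge y yP) h.
  rewrite (bigD1 j)//= [leRHS](bigD1 j)//= {1}/y eqxx.
  rewrite (eq_bigr (fun i => surplus (u i) p (x i))) ?lerD2r//.
  by move=> i /andP[_ /negPf ij]; rewrite /y ij.
have xal : allocation u S x by move=> j /xP[].
split=> [|b db]; first by exists x.
rewrite -!/(surplus _ _ _); have [y [yP _ ->]] := attained b db.
apply: le_trans (ge x xal); apply: ler_sum => j jS.
by have [_] := xP j jS; apply; exact: yP.
Qed.

Lemma aggregate_two_demands u S p j b b' : j \in S -> b <> b' ->
  demand (u j) p b -> demand (u j) p b' ->
  exists a a', [/\ a <> a', demand (aggregate u S) p a &
    demand (aggregate u S) p a'].
Proof.
move=> jS bb' pb pb'.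
have /boolp.choice[x xP] := fun j => demand_nonempty (u j) p.
pose y c i := if i == j then c else x i.
have yP c : demand (u j) p c -> demand (aggregate u S) p (\sum_(i in S) y c i).
  move=> pc; apply/demand_aggregateP; exists (y c) => // i _; rewrite /y.
  by case: eqP => [->|].
exists (\sum_(i in S) y b i), (\sum_(i in S) y b' i); split; try exact: yP.
rewrite (bigD1 j)//= [RHS](bigD1 j)//= {1 3}/y eqxx => e; apply: bb'.
move: e; rewrite (eq_bigr x) => [|i /andP[_ /negPf ij]]; last by rewrite /y ij.
rewrite [in RHS](eq_bigr x) => [/addIr//|i /andP[_ /negPf ij]]; by rewrite /y ij.
Qed.

End Demand.

(** * Stable auctions *)

Section StableAuctions.
Local Open Scope classical_set_scope.
Local Open Scope ring_scope.
Context {R : realType} {I : finType}.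
Local Notation embed := (@embed R 2).
Local Notation closed := (@hull_closed R).
Implicit Types (u : I -> valuation R 2) (S T : {set I}) (p : 'rV[R]_2).

Lemma demand_price_exists (v : valuation R 2) a : convZ R (dom v) a ->
  exists p, convZ R (demand v p) a.
Proof.
move=> /(supporting_price (value v) (dom_finite v))[p [c [pc pa]]].
exists p; apply: hull_mono pa; apply: image_subset => s [ds sc].
by split=> // b db; rewrite sc; exact: pc.
Qed.

Lemma equilibrium_demand_closed u S p : competitive_equilibrium u S ->
  closed (demand (aggregate u S) p).
Proof.
move=> eqS b pb.
have [|q qb] := eqS b; last exact: demand_of_supported qb pb.
by apply: hull_mono pb; apply: image_subset => s [].
Qed.

Lemma cross_dotr (d x : 'rV[int]_2) :
  (cross d x)%:~R = dotr (\row_i (if i == 0 then - (d 0 1)%:~R else (d 0 0)%:~R)) (embed x).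
Proof.
rewrite /cross /dotr big_ord_recl big_ord1 !mxE /= rmorphB !rmorphM /=.
have -> : lift ord0 ord0 = 1 :> 'I_2 by apply/val_inj.
by have -> : ord0 = 0 :> 'I_2 by []; ring.
Qed.

(** At [p - e *: w] with small [e], demand sets shrink to their faces in direction [w]. An edge of
    agent [j] puts this price on the hypersurface of [S], hence on that of [T], whose face then has
    two points. *)
Lemma hypersurface_edges_refine u S T j p : j \in S ->
  trop_hypersurface (aggregate u S) `<=` trop_hypersurface (aggregate u T) ->
  edges_refine (demand (u j) p) (demand (aggregate u T) p).
Proof.
move=> jS sub d [q [q' [pq pq' qq' qmax]]].
pose w : 'rV[R]_2 := \row_i (if i == 0 then - (d 0 1)%:~R else (d 0 0)%:~R).
have wE x : dotr w (embed x) = (cross d x)%:~R by rewrite cross_dotr.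
have [e1 e1_gt0 e1P] := demand_perturb (u j) p w.
have [e2 e2_gt0 e2P] := demand_perturb (aggregate u T) p w.
pose e := Num.min e1 e2 / 2.
have m0 : 0 < Num.min e1 e2 by rewrite lt_min e1_gt0.
have em : e < Num.min e1 e2 by rewrite /e; lra.
have e0 : 0 < e by rewrite /e; lra.
move: em; rewrite lt_min => /andP[ee1 ee2].
have {}e1P := e1P e ltac:(by rewrite e0); have {}e2P := e2P e ltac:(by rewrite e0).
have [a [a' [aa' pa pa']]] : exists a a', [/\ a <> a',
    demand (aggregate u T) (p - e *: w) a & demand (aggregate u T) (p - e *: w) a'].
  apply/trop_hypersurfaceP; apply: sub; apply/trop_hypersurfaceP.
  apply: (aggregate_two_demands jS qq').
  - by apply/e1P; split=> // b pb; rewrite !wE ler_int (qmax b pb).1.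
  - by apply/e1P; split=> // b pb; rewrite !wE ler_int (qmax b pb).2.
have [pa1 pa2] := (e2P a).1 pa; have [pa'1 pa'2] := (e2P a').1 pa'.
exists a, a'; split=> // x px.
by have := pa2 x px; have := pa'2 x px; rewrite !wE !ler_int.
Qed.

Lemma demand_aggregateU1 u S j p : j \notin S ->
  demand (aggregate u (j |: S)%SET) p =
  minkowski (demand (aggregate u S) p) (demand (u j) p).
Proof.
move=> jS; apply/seteqP; split=> a.
  move=> /demand_aggregateP[x xP ->]; rewrite big_setU1//= addrC.
  exists (\sum_(i in S) x i); last by exists (x j) => //; apply: xP; rewrite setU11.
  by apply/demand_aggregateP; exists x => // i iS; apply: xP; rewrite setU1r.
move=> [_ /demand_aggregateP[x xP ->] [b pb <-]]; apply/demand_aggregateP.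
exists (fun i => if i == j then b else x i).
  move=> i; case: eqP => [->//|/eqP ij]; rewrite !inE (negPf ij)/=; exact: xP.
rewrite big_setU1//= eqxx addrC; congr (_ + _); apply: eq_bigr => i iS.
by case: eqP => // ij; move: jS; rewrite -ij iS.
Qed.

(** The edge of [P] is translated by a point of [T] extremal in the same direction. *)
Lemma edges_refine_minkowski (P Q T : set 'rV[int]_2) : finite_set T -> T !=set0 ->
  edges_refine Q P -> edges_refine Q (minkowski P T).
Proof.
move=> finT T0 ref d /ref[a [a' [Pa Pa' aa' amax]]].
have [m Tm mmax] := finite_argmax (fun x => (cross d x)%:~R : R) finT T0.
exists (a + m), (a' + m); split; [by exists a => //; exists m|by exists a' => //; exists m| |].
  by move=> /addIr.
move=> _ [s Ps [t Tt <-]]; rewrite !crossD.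
have := mmax t Tt; rewrite ler_int => tm; have [] := amax s Ps.
by split; apply: lerD.
Qed.

(** Induction on the number of agents outside [S1]. The refinement is carried along because it is
    needed again for the next agent. *)
Lemma stable_demand_closed u p S1 : (forall j, concave_valuation (u j)) ->
  competitive_equilibrium u S1 ->
  (forall j, edges_refine (demand (u j) p) (demand (aggregate u S1) p)) ->
  forall T, S1 \subset T -> closed (demand (aggregate u T) p).
Proof.
move=> uconc eq1 ref1 T S1T.
suff: closed (demand (aggregate u T) p) /\
    forall j, edges_refine (demand (u j) p) (demand (aggregate u T) p) by case.
have [k] := ubnP #|T :\: S1|; elim: k T S1T => // k IHk T S1T; rewrite ltnS => Tk.
have [T0|[j jT]] := set_0Vmem (T :\: S1).
  have -> : T = S1 by apply/eqP; rewrite finset.eqEsubset S1T andbT -finset.setD_eq0 T0.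
  by split=> //; exact: equilibrium_demand_closed.
move: (jT); rewrite !inE => /andP[jS1 jTT].
have [||Tcl Tref] := IHk (T :\ j)%SET.
- apply/fintype.subsetP => i iS1; rewrite !inE (fintype.subsetP S1T)// andbT.
  by apply: contraNneq jS1 => <-.
- apply: leq_trans Tk; apply: proper_card; apply/properP; split.
    by apply: finset.setSD; exact: finset.subD1set.
  by exists j => //; rewrite !inE eqxx/= andbF.
have -> : T = (j |: (T :\ j))%SET by rewrite finset.setD1K.
rewrite demand_aggregateU1; last by rewrite !inE eqxx.
split=> [|i].
  apply: minkowski_hull_closed => //; try exact: demand_finite.
  exact: concave_demand_closed.
apply: edges_refine_minkowski => //; first exact: demand_finite.
exact: demand_nonempty.
Qed.

Lemma stable_auction_equilibrium u : (forall j, concave_valuation (u j)) ->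
  stable_auction u -> competitive_equilibrium u [set: I]%SET.
Proof.
move=> uconc [P [S1 [/and3P[/eqP covP _ _] S1P eq1 sub]]] a /demand_price_exists[p pa].
exists p; apply: stable_demand_closed eq1 _ _ _ _ pa => //.
move=> j; have : j \in finset.cover P by rewrite covP inE.
move=> /finset.bigcupP[S SP jS].
exact: hypersurface_edges_refine jS (sub S SP).
Qed.

End StableAuctions.

Theorem theorem6p4 (R : realType) (J : nat) (hJ : (1 <= J)%N)
    (u : 'I_J -> valuation R 2) :
  (forall j : 'I_J, concave_valuation (u j)) ->
  stable_auction u ->
  forall a : 'rV[int]_2,
    convZ R (dom (aggregate u [set: 'I_J]%SET)) a ->
    exists p : 'rV[R]_2, demand (aggregate u [set: 'I_J]%SET) p a.
Proof. exact: stable_auction_equilibrium. Qed.
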